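(* For every positive integer $n$, at $q=e^{\mathrm i\pi/6}$ the QAST partition function at $u_{n+1}=p$, $Z^{\uparrow}_n(u_1,\ldots,u_n;p)_{\mathrm{QAST}}$, is equal to $$3^{-\binom{n+1}{2}} \prod_{i=1}^{n} (p ^2 u_i^2 + 1 + \bar p^2 \bar u_i^2)\; s_{(n,n-1,n-1,n-2,n-2,\ldots,1,1)}(u_1^2,\bar u_1^2,\ldots,u_n^2, \bar u_n^2).$$
   Context: Here $p,u_1,\dots,u_{n+1}$ are indeterminates; write $\bar x=x^{-1}$ and $\sigma(x)=x-\bar x$. $s_\lambda(x_1,\dots,x_m)=\det_{1\le i,j\le m}(x_i^{\lambda_j+m-j})/\prod_{1\le i<j\le m}(x_i-x_j)$ is the Schur function, with $\lambda$ padded with zero parts to have $m$ parts (here $m=2n$). Graph. Let $\mathcal T_n$ be the graph with vertices $(0,j)$, $1\le j\le 2n+1$, and $(i,j)$, $1\le i\le n+1$, $i\le j\le 2n+2-i$ (matrix coordinates: $i$ increases downwards, $j$ increases to the right). Vertical edges join $(i-1,j)$ and $(i,j)$ whenever both are vertices; horizontal edges join $(i,j)$ and $(i,j+1)$ whenever both are vertices and $i\ge1$. Bulk vertices: $(i,j)$ with $1\le i\le n$, $i<j<2n+2-i$ (degree 4). Left boundary vertices: $(i,i)$, $1\le i\le n$ (one edge going up, one going right). Right boundary vertices: $(i,2n+2-i)$, $1\le i\le n$ (one edge going up, one going left). The remaining vertices have degree 1; among them $(n+1,n+1)$ is the bottom vertex, and its unique edge is the bottom vertical edge. A configuration is an orientation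 of $\mathcal T_n$ such that each bulk vertex has two incoming and two outgoing edges and each top edge is directed upwards (from $(1,j)$ to $(0,j)$). The label of the bulk vertex $(i,j)$ is $u_iu_{\min(j,2n+2-j)}$, and the label of the boundary vertices $(i,i)$ and $(i,2n+2-i)$ is $u_i$. The weight of a configuration is the product of all vertex weights; degree 1 vertices have weight 1, and the other vertices, with label $u$, have the following weights. Bulk: weight $1$ if both vertical edges are outgoing or both are incoming; $\sigma(q^2u)/\sigma(q^4)$ if both vertical edges point up and both horizontal edges point right, or both vertical edges point down and both horizontal edges point left; $\sigma(q^2\bar u)/\sigma(q^4)$ if both vertical edges point down and both horizontal edges point right, or both vertical edges point up and both horizontal edges point left. Left boundary (QAST specialization): vertical edge outgoing and horizontal edge incoming: $\sigma(pq^2u)/\sigma(q^2)$; vertical edge incoming and horizontal edge outgoing: $\sigma(p\bar u)/\sigma(q^2)$; both incoming: $0$; both outgoing: $\sigma(q^2u^2)/\sigma(q^2)$. Right boundary (QAST specialization): vertical edge outgoing and horizontal edge incoming: $\sigma(\bar pq^2\bar u)/\sigma(q^2)$; vertical edge incoming and horizontal edge outgoing: $\sigma(\bar pu)/\sigma(q^2)$; both incoming: $0$; both outgoing: $\sigma(q^2\bar u^2)/\sigma(q^2)$. $Z^{\uparrow}_n(u_1,\dots,u_n;u_{n+1})_{\mathrm{QAST}}$ is the sum of the weights of all configurations in which the bottom vertical edge points up (from $(n+1,n+1)$ to $(n,n+1)$). *)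

(* Defs.v *)
From HB Require Import structures.
From mathcomp Require Import all_boot all_order all_algebra.
From mathcomp Require Import reals trigo complex.
From mathcomp Require Import mpoly.

Set Implicit Arguments.
Unset Strict Implicit.
Unset Printing Implicit Defensive.

Import GRing.Theory Num.Theory.
Local Open Scope ring_scope.

Section Graph.
Local Open Scope nat_scope.
Variable n : nat.

(* Vertices of T_n are matrix coordinates (row i, column j), with the
   1-based numbering of rows 1..n+1 and columns 1..2n+1; row 0 is the top. *)
Definition is_vertex (i j : nat) : bool :=
  (i == 0) && (1 <= j <= 2 * n + 1)
  || (1 <= i <= n.+1) && (i <= j <= 2 * n + 2 - i).

(* The vertical edge (i - 1, j) -- (i, j) is indexed by its lower end (i, j). *)
Definition is_vedge (i j : nat) : bool :=
  [&& 1 <= i, is_vertex i.-1 j & is_vertex i j].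

(* The horizontal edge (i, j) -- (i, j + 1) is indexed by its left end (i, j). *)
Definition is_hedge (i j : nat) : bool :=
  [&& 1 <= i, is_vertex i j & is_vertex i j.+1].

Definition is_bulk (i j : nat) : bool :=
  (1 <= i <= n) && (i < j < 2 * n + 2 - i).

Definition grid := ('I_n.+2 * 'I_(2 * n).+2)%type.

(* An orientation of T_n, given by the set of the vertical edges that point up
   and the set of the horizontal edges that point right. *)
Definition orientation := ({set grid} * {set grid})%type.

Definition is_orientation (o : orientation) : bool :=
  (o.1 \subset [set e : grid | is_vedge e.1 e.2])
  && (o.2 \subset [set e : grid | is_hedge e.1 e.2]).

Definition points_up (o : orientation) (i j : nat) : bool :=
  (inord i, inord j) \in o.1.

Definition points_right (o : orientation) (i j : nat) : bool :=
  (inord i, inord j) \in o.2.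

(* Only meaningful at bulk vertices: the four summands stand for the edges
   above, below, to the left and to the right of (i, j). *)
Definition bulk_indeg (o : orientation) (i j : nat) : nat :=
  ~~ points_up o i j + points_up o i.+1 j
  + points_right o i j.-1 + ~~ points_right o i j.

Definition bulk_outdeg (o : orientation) (i j : nat) : nat :=
  points_up o i j + ~~ points_up o i.+1 j
  + ~~ points_right o i j.-1 + points_right o i j.

Definition is_config (o : orientation) : bool :=
  [&& is_orientation o,
      [forall v : grid, is_bulk v.1 v.2 ==>
         (bulk_indeg o v.1 v.2 == 2) && (bulk_outdeg o v.1 v.2 == 2)]
    & [forall j : 'I_(2 * n).+2, is_vedge 1 j ==> points_up o 1 j]].

Definition bottom_up (o : orientation) : bool := points_up o n.+1 n.+1.

End Graph.

Section Weights.
Variable K : fieldType.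
Variables q p : K.

Definition sigma (x : K) : K := x - x^-1.

(* N, S: the edge above (resp. below) points up;
   W, E: the edge to the left (resp. right) points right.
   The last case only covers patterns that violate the two-in two-out rule. *)
Definition bulk_weight (u : K) (N S W E : bool) : K :=
  match N, S, W, E with
  | true, false, true, false | false, true, false, true => 1
  | true, true, true, true | false, false, false, false =>
      sigma (q ^+ 2 * u) / sigma (q ^+ 4)
  | false, false, true, true | true, true, false, false =>
      sigma (q ^+ 2 * u^-1) / sigma (q ^+ 4)
  | _, _, _, _ => 0
  end.

(* N: the vertical edge is outgoing; E: the horizontal edge is outgoing. *)
Definition left_weight (u : K) (N E : bool) : K :=
  match N, E with
  | true, false => sigma (p * q ^+ 2 * u) / sigma (q ^+ 2)
  | false, true => sigma (p * u^-1) / sigma (q ^+ 2)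
  | false, false => 0
  | true, true => sigma (q ^+ 2 * u ^+ 2) / sigma (q ^+ 2)
  end.

(* N: the vertical edge is outgoing; W: the horizontal edge is outgoing. *)
Definition right_weight (u : K) (N W : bool) : K :=
  match N, W with
  | true, false => sigma (p^-1 * q ^+ 2 * u^-1) / sigma (q ^+ 2)
  | false, true => sigma (p^-1 * u) / sigma (q ^+ 2)
  | false, false => 0
  | true, true => sigma (q ^+ 2 * u^-1 ^+ 2) / sigma (q ^+ 2)
  end.

Variable n : nat.
Variables (u : 'I_n -> K) (v : K).

(* u_k for 1 <= k <= n + 1, where u_{n+1} is v and u is indexed from 0. *)
Definition spectral (k : nat) : K := oapp u v (insub k.-1).

Definition config_weight (o : orientation n) : K :=
  (\prod_(1 <= i < n.+1) \prod_(i.+1 <= j < 2 * n + 2 - i)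
     bulk_weight (spectral i * spectral (minn j (2 * n + 2 - j)))
       (points_up o i j) (points_up o i.+1 j)
       (points_right o i j.-1) (points_right o i j))
  * (\prod_(1 <= i < n.+1)
       left_weight (spectral i) (points_up o i i) (points_right o i i))
  * (\prod_(1 <= i < n.+1)
       right_weight (spectral i) (points_up o i (2 * n + 2 - i))
         (~~ points_right o i (2 * n + 1 - i))).

Definition Zup_QAST : K :=
  \sum_(o : orientation n | is_config o && bottom_up o) config_weight o.

End Weights.

Definition schur (K : fieldType) (m : nat) (la : seq nat) (x : 'I_m -> K) : K :=
  \det (\matrix_(i < m, j < m) x i ^+ (nth 0%N la j + (m - j.+1)))
  / \prod_(i < m) \prod_(j < m | (i < j)%N) (x i - x j).

(* (n, n - 1, n - 1, n - 2, n - 2, ..., 1, 1) *)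
Definition double_staircase (n : nat) : seq nat :=
  n :: flatten [seq [:: k; k] | k <- rev (iota 1 n.-1)].

(* (u_1^2, u_1^-2, ..., u_n^2, u_n^-2) *)
Definition squares_inv (K : fieldType) (n : nat) (u : 'I_n -> K)
    (k : 'I_(2 * n)) : K :=
  (flatten [seq [:: u i ^+ 2; u i ^- 2] | i <- enum 'I_n])`_k.

(* The field C(p, u_1, ..., u_n), with C = R[i]. *)
Definition ratfun (R : realType) (n : nat) : fieldType :=
  {fraction {mpoly R[i][n.+1]}}.

Definition indet_p (R : realType) (n : nat) : ratfun R n :=
  FracField.tofrac ('X_ord0 : {mpoly R[i][n.+1]}).

Definition indet_u (R : realType) (n : nat) (k : 'I_n) : ratfun R n :=
  FracField.tofrac ('X_(lift ord0 k) : {mpoly R[i][n.+1]}).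

(* e^(i t) *)
Definition expi (R : realType) (t : R) : R[i] := (cos t +i* sin t)%C.

Definition const_q (R : realType) (n : nat) : ratfun R n :=
  FracField.tofrac ((expi (pi / 6%:R))%:MP : {mpoly R[i][n.+1]}).

(* Main.v *)
Require Import Defs.
From HB Require Import structures.
From mathcomp Require Import all_boot all_order all_algebra.
From mathcomp Require Import reals trigo complex.
From mathcomp Require Import mpoly.
From mathcomp Require Import fingroup perm.
From mathcomp Require Import ring zify.

(* The partition function and the right-hand side obey the same recursions in n.
   A row of the triangle is a line u_i that enters at the top left, is reflected
   at both ends and leaves at the top right. The Yang-Baxter and reflection
   equations make the partition function symmetric in the u_i. Only the first row
   contains u_1, so u_1 ^ (2 n + 2) times the partition function is a polynomial
   of degree at most 2 n + 2 in x = u_1 ^ 2. It is determined by its values at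
   - the four x with x ^ 2 = q ^ 4 or q ^ -4: the first row is frozen and the
     order drops by one;
   - the two x with p ^ 2 x = q ^ 4 or q ^ -4: the value is 0, as one sees after
     moving u_1 to the innermost row;
   - the 2 (n - 1) values of x with u_1 u_j = q ^ 2 or q ^ -2: after moving u_j
     next to u_1 two rows are frozen and the order drops by two.
   For q = e ^ (i pi / 6) the Schur function satisfies the same recursions, since
   at x' = w x'', with w a primitive cube root of unity, the bialternant of the
   double staircase loses the variables x', x''. *)

Set Implicit Arguments.
Unset Strict Implicit.
Unset Printing Implicit Defensive.

Import GRing.Theory Num.Theory.
Local Open Scope ring_scope.

(** The specialization u_{n+1} = p makes the number of points sufficient. Frozen rows give 4 + 2 (n
    - 1) = 2 n + 2 values, one fewer than a polynomial of degree 2 n + 2 requires; the innermost row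
    supplies two zeros because there the central column and the corners share the parameter p. The
    value of q enters in two ways: [sigma (q ^+ 4) = sigma (q ^+ 2)], with square -3, gives bulk and
    corner weights a common denominator, and q ^ 4 is a primitive cube root of unity, so that the
    bialternant factorizes where rows freeze. At these points the parameters are algebraically
    dependent, so the induction cannot stay with indeterminates. It is carried out for field
    elements in general position, required of p and the other parameters; the special one only has
    to keep the denominator of the Schur function non-zero. The partition function is defined for
    arbitrary top edges because the exchange of two rows is an identity between operators; it
    becomes a symmetry on edges that all point up, where the R-matrix is a scalar. *)

Lemma split_bits (k m : nat) (t : seq bool) : size t = (k + m.+2)%N ->
  exists t1 a b t2, [/\ t = t1 ++ a :: b :: t2, size t1 = k & size t2 = m].
Proof.
move=> st; exists (take k t), (nth false t k), (nth false t k.+1), (drop k.+2 t).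
split; last 2 first.
- by rewrite size_take st; case: ltnP => //; lia.
- by rewrite size_drop st; lia.
have lt1 : (k < size t)%N by rewrite st; lia.
have lt2 : (k.+1 < size t)%N by rewrite st; lia.
by rewrite -(drop_nth _ lt2) -(drop_nth _ lt1) cat_take_drop.
Qed.

(** * Sums over bit sequences of a given length *)

Section SumBits.
Variable K : fieldType.

(** Iterated Boolean sums follow the recursion along a row, and local identities become polynomial
    ones once the sums over [bool] are expanded. *)
Fixpoint sum_bits (m : nat) (F : seq bool -> K) : K :=
  if m is m'.+1 then \sum_(b : bool) sum_bits m' (fun s => F (b :: s))
  else F [::].

Lemma eq_sum_bits m F G :
  (forall s, size s = m -> F s = G s) -> sum_bits m F = sum_bits m G.
Proof.
elim: m F G => [|m IH] F G FG /=; first exact: FG.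
by apply: eq_bigr => b _; apply: IH => s sz; apply: FG; rewrite /= sz.
Qed.

Lemma sum_bits0 m : sum_bits m (fun=> 0) = 0.
Proof. by elim: m => //= m IH; rewrite big1. Qed.

Lemma sum_bitsZ m c F : sum_bits m (fun s => c * F s) = c * sum_bits m F.
Proof.
elim: m F => //= m IH F; rewrite mulr_sumr.
by apply: eq_bigr => b _; rewrite IH.
Qed.

Lemma sum_bitsZr m c F : sum_bits m (fun s => F s * c) = sum_bits m F * c.
Proof. by rewrite mulrC -sum_bitsZ; apply: eq_sum_bits => s _; rewrite mulrC. Qed.

Lemma sum_bits_sum (I : finType) m (F : I -> seq bool -> K) :
  sum_bits m (fun s => \sum_i F i s) = \sum_i sum_bits m (F i).
Proof.
elim: m F => //= m IH F; rewrite exchange_big.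
by apply: eq_bigr => b _; rewrite IH.
Qed.

Lemma exchange_sum_bits m1 m2 (F : seq bool -> seq bool -> K) :
  sum_bits m1 (fun s => sum_bits m2 (F s)) =
  sum_bits m2 (fun t => sum_bits m1 (fun s => F s t)).
Proof.
elim: m1 F => //= m1 IH F; rewrite sum_bits_sum.
by apply: eq_bigr => b _; rewrite IH.
Qed.

Lemma sum_bits_cat m1 m2 F :
  sum_bits (m1 + m2) F =
  sum_bits m1 (fun s => sum_bits m2 (fun t => F (s ++ t))).
Proof.
elim: m1 F => //= m1 IH F; apply: eq_bigr => b _; exact: IH.
Qed.

Lemma sum_bits_single m F s0 :
  size s0 = m -> (forall s, size s = m -> s != s0 -> F s = 0) ->
  sum_bits m F = F s0.
Proof.
elim: m F s0 => [|m IH] F [|b s0] //= [sz] F0.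
rewrite (bigD1 b) //= big1 ?addr0 => [|c ncb].
  apply: (IH (fun s => F (b :: s))) => // s szs ns; apply: F0; first by rewrite /= szs.
  by rewrite eqseq_cons eqxx.
rewrite (@eq_sum_bits _ _ (fun=> 0)) ?sum_bits0 // => s szs.
by apply: F0; rewrite ?[in LHS]/= ?szs // eqseq_cons (negPf ncb).
Qed.

End SumBits.

(** * Row-by-row partition function *)

Section PartitionFunction.
Variables (K : fieldType) (q p v : K).

Implicit Types (u w z : K) (zs us : seq K) (e f : bool) (t bs : seq bool).

Local Notation continuation := (bool -> seq bool -> seq bool -> K).

(* Throughout, true means up or right. A row is read from left to right: it
   enters the columns zs on the edge e, crosses the vertical edges t (above) and
   bs (below), and k describes what it meets afterwards. *)
Fixpoint hline u zs e t bs (k : continuation) : K :=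
  if zs is z :: zs' then
    if (t, bs) is (n :: t', s :: bs') then
      \sum_(f : bool) bulk_weight q (u * z) n s e f * hline u zs' f t' bs' k
    else 0
  else k e t bs.

Definition right_end u : continuation := fun e t bs =>
  if (t, bs) is ([:: r], [::]) then right_weight q p u r (~~ e) else 0.

Definition row_weight u zs t bs : K :=
  if t is l :: t' then
    \sum_(e : bool) left_weight q p u l e * hline u zs e t' bs (right_end u)
  else 0.

Definition row_op u zs (F : seq bool -> K) t : K :=
  sum_bits (size zs) (fun bs => row_weight u zs t bs * F bs).

(* The sum over the triangle whose rows have parameters us and whose top edges
   are t; v is the parameter of the central column. *)
Fixpoint Zrec us : seq bool -> K :=
  if us is u :: us' then row_op u (us' ++ v :: rev us') (Zrec us')
  else fun t => (t == [:: true])%:R.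

Lemma hline_cat u (z1 z2 : seq K) e t bs k :
  hline u (z1 ++ z2) e t bs k =
  hline u z1 e t bs (fun f t' bs' => hline u z2 f t' bs' k).
Proof.
elim: z1 e t bs => //= z z1 IH e [|n t] [|s bs] //.
by apply: eq_bigr => f _; rewrite IH.
Qed.

Lemma row_op_ext u zs F G t :
  (forall bs, size bs = size zs -> F bs = G bs) ->
  row_op u zs F t = row_op u zs G t.
Proof. by move=> FG; apply: eq_sum_bits => bs sz; rewrite FG. Qed.

(* The R-matrix: weight of an extra crossing, turning the edges a, b into c, d,
   of two adjacent parallel lines, whether vertical or horizontal. *)
Definition rmat u w (a b c d : bool) : K :=
  if (a == c) && (b == d) then
    if a == b then sigma (q ^+ 4 * w / u) else sigma (q ^+ 4)
  else if (a == d) && (b == c) then - sigma (w / u) else 0.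

Definition rmat_at u w k (F : seq bool -> K) t : K :=
  if drop k t is a :: b :: t' then
    \sum_(c : bool) \sum_(d : bool)
      rmat u w a b c d * F (take k t ++ c :: d :: t')
  else 0.

Hypothesis q_neq0 : q != 0.
Hypothesis p_neq0 : p != 0.
Hypothesis sq2_neq0 : sigma (q ^+ 2) != 0.
Hypothesis sq4_neq0 : sigma (q ^+ 4) != 0.

(** This and the next lemma put the hypotheses on [sigma] into the shape of the side conditions of
    [field] in the identities below. *)
Lemma q2_sq_neq1 : (q * q) ^+ 2 - 1 != 0.
Proof.
apply: contraNneq sq2_neq0 => q4.
have -> : sigma (q ^+ 2) = ((q * q) ^+ 2 - 1) / q ^+ 2 by rewrite /sigma; field.
by rewrite q4 mul0r.
Qed.

Lemma q2_quad_neq1 : (q * q) ^+ 4 - 1 != 0.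
Proof.
apply: contraNneq sq4_neq0 => q8.
have -> : sigma (q ^+ 4) = ((q * q) ^+ 4 - 1) / q ^+ 4 by rewrite /sigma; field.
by rewrite q8 mul0r.
Qed.

(** Yang-Baxter equation with the R-matrix on two vertical lines: each of the 64 patterns of outer
    edges is a rational identity. *)
Lemma ybe_columns u w z (t1 t2 b1 b2 e f : bool) :
  u != 0 -> w != 0 -> z != 0 ->
  \sum_(c : bool) \sum_(d : bool) rmat u w t1 t2 c d *
    \sum_(g : bool) bulk_weight q (z * u) c b1 e g * bulk_weight q (z * w) d b2 g f =
  \sum_(c : bool) \sum_(d : bool)
    (\sum_(g : bool) bulk_weight q (z * w) t1 c e g * bulk_weight q (z * u) t2 d g f)
    * rmat u w c d b1 b2.
Proof.
move=> u0 w0 z0; rewrite !big_bool /rmat.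
case: t1; case: t2; case: b1; case: b2; case: e; case: f;
  rewrite /= ?mul0r ?mulr0 ?addr0 ?add0r; try by [].
all: by rewrite /sigma; field; rewrite ?q2_quad_neq1 ?q_neq0 ?u0 ?w0 ?z0.
Qed.

(** Two vertices of the column of parameter [z], one above the other; index 1 belongs to the upper
    row, of parameter [u]. *)
Definition col_pair u w z (n s e1 e2 f1 f2 : bool) : K :=
  \sum_(g : bool)
    bulk_weight q (u * z) n g e1 f1 * bulk_weight q (w * z) g s e2 f2.

(** The left ends of two consecutive rows: both corners and the vertex of label [u * w] above the
    lower corner. *)
Definition left_pair u w (t1 t2 e1 e2 : bool) : K :=
  \sum_(g : bool) \sum_(f : bool) left_weight q p u t1 f
    * bulk_weight q (u * w) t2 g f e1 * left_weight q p w g e2.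

Definition right_pair u w (t1 t2 e1 e2 : bool) : K :=
  \sum_(g : bool) \sum_(f : bool) bulk_weight q (u * w) t1 g e1 f
    * right_weight q p u t2 (~~ f) * right_weight q p w g (~~ e2).

Lemma ybe_rows u w z (n s e1 e2 f1 f2 : bool) :
  u != 0 -> w != 0 -> z != 0 ->
  \sum_(c : bool) \sum_(d : bool)
    rmat u w e1 e2 c d * col_pair u w z n s c d f1 f2 =
  \sum_(c : bool) \sum_(d : bool)
    col_pair w u z n s e1 e2 c d * rmat u w c d f1 f2.
Proof.
move=> u0 w0 z0; rewrite /col_pair !big_bool /rmat.
case: n; case: s; case: e1; case: e2; case: f1; case: f2;
  rewrite /= ?mul0r ?mulr0 ?addr0 ?add0r; try by [].
all: by rewrite /sigma; field; rewrite ?q2_quad_neq1 ?q_neq0 ?u0 ?w0 ?z0.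
Qed.

(** Reflection equation. Lines turn from vertical to horizontal at their left corners, so the
    R-matrix enters on two columns and leaves on two rows. *)
Lemma reflection_left u w (t1 t2 e1 e2 : bool) :
  u != 0 -> w != 0 ->
  \sum_(c : bool) \sum_(d : bool)
    rmat u w t1 t2 c d * left_pair u w c d e1 e2 =
  \sum_(c : bool) \sum_(d : bool)
    left_pair w u t1 t2 c d * rmat u w c d e1 e2.
Proof.
move=> u0 w0; rewrite /left_pair !big_bool /rmat.
case: t1; case: t2; case: e1; case: e2;
  rewrite /= ?mul0r ?mulr0 ?addr0 ?add0r; try by [].
all: rewrite ?mul0r ?mulr0 ?addr0 ?add0r; try by [].
all: by rewrite /sigma; field; rewrite ?q2_sq_neq1 ?q2_quad_neq1 ?q_neq0 ?p_neq0 ?u0 ?w0.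
Qed.

(** Here the R-matrix passes from the rows back to the columns, so that it can leave through the top
    edges. *)
Lemma reflection_right u w (t1 t2 e1 e2 : bool) :
  u != 0 -> w != 0 ->
  \sum_(c : bool) \sum_(d : bool)
    rmat u w e1 e2 c d * right_pair u w t1 t2 c d =
  \sum_(c : bool) \sum_(d : bool)
    rmat u w t1 t2 c d * right_pair w u c d e1 e2.
Proof.
move=> u0 w0; rewrite /right_pair !big_bool /rmat.
case: t1; case: t2; case: e1; case: e2;
  rewrite /= ?mul0r ?mulr0 ?addr0 ?add0r; try by [].
all: rewrite ?mul0r ?mulr0 ?addr0 ?add0r; try by [].
all: by rewrite /sigma; field; rewrite ?q2_sq_neq1 ?q2_quad_neq1 ?q_neq0 ?p_neq0 ?u0 ?w0.
Qed.

End PartitionFunction.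

Arguments row_weight : simpl never.

(** * Symmetry *)

Section Exchange.
Variables (K : fieldType) (q p v : K).
Hypothesis q_neq0 : q != 0.
Hypothesis p_neq0 : p != 0.
Hypothesis sq2_neq0 : sigma (q ^+ 2) != 0.
Hypothesis sq4_neq0 : sigma (q ^+ 4) != 0.

Implicit Types (u w z : K) (zs us : seq K) (e f : bool) (t bs : seq bool).

Local Notation hline := (hline q).
Local Notation row_weight := (row_weight q p).
Local Notation row_op := (row_op q p).
Local Notation rmat := (rmat q).
Local Notation rmat_at := (rmat_at q).
Local Notation Zrec := (Zrec q p v).
Local Notation right_end := (right_end q p).
Local Notation col_pair := (col_pair q).
Local Notation left_pair := (left_pair q p).
Local Notation right_pair := (right_pair q p).
Local Notation ybe_columns := (ybe_columns q_neq0 sq4_neq0).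
Local Notation ybe_rows := (ybe_rows q_neq0 sq4_neq0).
Local Notation reflection_left := (reflection_left q_neq0 p_neq0 sq2_neq0 sq4_neq0).
Local Notation reflection_right := (reflection_right q_neq0 p_neq0 sq2_neq0 sq4_neq0).

Lemma hline_rmat (x : K) (zs1 zs2 : seq K) u w e a b c' d' t1 t2 bs1 bs2 k :
  u != 0 -> w != 0 -> x != 0 -> size t1 = size zs1 -> size bs1 = size zs1 ->
  \sum_(c : bool) \sum_(d : bool) rmat u w a b c d *
    hline x (zs1 ++ u :: w :: zs2) e (t1 ++ c :: d :: t2)
      (bs1 ++ c' :: d' :: bs2) k =
  \sum_(c : bool) \sum_(d : bool)
    hline x (zs1 ++ w :: u :: zs2) e (t1 ++ a :: b :: t2)
      (bs1 ++ c :: d :: bs2) k * rmat u w c d c' d'.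
Proof.
move=> u0 w0 x0.
elim: zs1 e t1 bs1 => [|z zs1 IH] e [|n t1] [|s bs1] //=.
  move=> _ _.
  have Y g := ybe_columns a b c' d' e g u0 w0 x0.
  transitivity (\sum_(g : bool) (\sum_(c : bool) \sum_(d : bool) rmat u w a b c d *
     \sum_(f : bool) bulk_weight q (x * u) c c' e f * bulk_weight q (x * w) d d' f g)
     * hline x zs2 g t2 bs2 k).
    rewrite !big_bool /=; ring.
  under [LHS]eq_bigr => g _ do rewrite Y.
  rewrite !big_bool /=; ring.
move=> [st] [sb].
have H f := IH f t1 bs1 st sb.
transitivity (\sum_(f : bool) bulk_weight q (x * z) n s e f *
  (\sum_(c : bool) \sum_(d : bool) rmat u w a b c d *
    hline x (zs1 ++ u :: w :: zs2) f (t1 ++ c :: d :: t2)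
      (bs1 ++ c' :: d' :: bs2) k)).
  rewrite !big_bool /=; ring.
under [LHS]eq_bigr => f _ do rewrite H.
rewrite !big_bool /=; ring.
Qed.

Lemma row_rmat (x : K) (zs1 zs2 : seq K) u w l a b c' d' t1 t2 bs1 bs2 :
  u != 0 -> w != 0 -> x != 0 -> size t1 = size zs1 -> size bs1 = size zs1 ->
  \sum_(c : bool) \sum_(d : bool) rmat u w a b c d *
    row_weight x (zs1 ++ u :: w :: zs2) (l :: t1 ++ c :: d :: t2)
      (bs1 ++ c' :: d' :: bs2) =
  \sum_(c : bool) \sum_(d : bool)
    row_weight x (zs1 ++ w :: u :: zs2) (l :: t1 ++ a :: b :: t2)
      (bs1 ++ c :: d :: bs2) * rmat u w c d c' d'.
Proof.
move=> u0 w0 x0 st sb.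
have H e := hline_rmat zs2 e a b c' d' t2 bs2 (right_end x) u0 w0 x0 st sb.
transitivity (\sum_(e : bool) left_weight q p x l e *
  (\sum_(c : bool) \sum_(d : bool) rmat u w a b c d *
    hline x (zs1 ++ u :: w :: zs2) e (t1 ++ c :: d :: t2)
      (bs1 ++ c' :: d' :: bs2) (right_end x))).
  rewrite /row_weight !big_bool /=; ring.
under [LHS]eq_bigr => f _ do rewrite H.
rewrite /row_weight !big_bool /=; ring.
Qed.

Lemma rmat_at_cat u w F t1 a b t2 k : k = size t1 ->
  rmat_at u w k F (t1 ++ a :: b :: t2) =
  \sum_(c : bool) \sum_(d : bool)
    rmat u w a b c d * F (t1 ++ c :: d :: t2).
Proof.
move=> ->; rewrite /rmat_at drop_size_cat //.
by do 2!apply: eq_bigr => ? _; rewrite take_size_cat.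
Qed.

(** The position above the row exceeds the one below by one, because the first edge above a row ends
    at its left corner, which has no edge below. *)
Lemma row_op_rmat (x : K) (zs1 zs2 : seq K) u w F t :
  u != 0 -> w != 0 -> x != 0 -> size t = (size zs1 + size zs2).+4 ->
  rmat_at u w (size zs1).+1 (row_op x (zs1 ++ u :: w :: zs2) F) t =
  row_op x (zs1 ++ w :: u :: zs2) (rmat_at u w (size zs1) F) t.
Proof.
move=> u0 w0 x0 st.
case: t st => // l t; rewrite /= => -[st].
have [|t1 [a [b [t2 [-> st1 st2]]]]] := @split_bits (size zs1) (size zs2).+1 t.
  by rewrite st; lia.
rewrite -cat_cons rmat_at_cat /= ?st1 // /row_op.
transitivity (sum_bits (size zs1) (fun s1 => \sum_(c' : bool) \sum_(d' : bool)
  sum_bits (size zs2) (fun s2 =>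
   (\sum_(c : bool) \sum_(d : bool) rmat u w a b c d *
    row_weight x (zs1 ++ u :: w :: zs2) (l :: t1 ++ c :: d :: t2)
      (s1 ++ c' :: d' :: s2)) * F (s1 ++ c' :: d' :: s2)))).
  under eq_bigr => c _ do under eq_bigr => d _ do
    rewrite size_cat sum_bits_cat /= -sum_bitsZ.
  under eq_bigr => c _ do rewrite -sum_bits_sum.
  rewrite -sum_bits_sum; apply: eq_sum_bits => s1 _.
  under eq_bigr => c _ do under eq_bigr => d _ do rewrite mulr_sumr.
  under eq_bigr => c _ do rewrite exchange_big.
  rewrite exchange_big /=; apply: eq_bigr => c' _.
  under eq_bigr => c _ do under eq_bigr => d _ do rewrite mulr_sumr.
  under eq_bigr => c _ do rewrite exchange_big.
  rewrite exchange_big /=; apply: eq_bigr => d' _.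
  under eq_bigr => c _ do under eq_bigr => d _ do rewrite -sum_bitsZ.
  under eq_bigr => c _ do rewrite -sum_bits_sum.
  rewrite -sum_bits_sum; apply: eq_sum_bits => s2 _.
  by rewrite !big_bool /=; ring.
rewrite size_cat sum_bits_cat; apply: eq_sum_bits => s1 ss1 /=.
under eq_bigr => c' _ do under eq_bigr => d' _ do under eq_sum_bits => s2 _
  do rewrite (row_rmat _ _ _ _ _ _ _ _ u0 w0 x0 st1 ss1).
under eq_bigr => c' _ do rewrite -sum_bits_sum.
rewrite -sum_bits_sum.
under [RHS]eq_bigr => c' _ do rewrite -sum_bits_sum.
rewrite -[RHS]sum_bits_sum.
apply: eq_sum_bits => s2 _.
under [RHS]eq_bigr => c _ do under eq_bigr => d _ do
  rewrite rmat_at_cat // mulr_sumr.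
rewrite !big_bool /=; ring.
Qed.

Local Arguments sum_bits : simpl never.

Lemma sum_bitsS m (F : seq bool -> K) :
  sum_bits m.+1 F = \sum_(b : bool) sum_bits m (fun s => F (b :: s)).
Proof. by []. Qed.

(* The line of u runs above that of w. *)
Fixpoint hline2 u w zs (e1 e2 : bool) t bs (k : bool -> bool -> K) : K :=
  if zs is z :: zs' then
    if (t, bs) is (n :: t', s :: bs') then
      \sum_(f1 : bool) \sum_(f2 : bool)
        col_pair u w z n s e1 e2 f1 f2 * hline2 u w zs' f1 f2 t' bs' k
    else 0
  else k e1 e2.

Lemma hline2_rmat u w zs e1 e2 t bs k1 k2 :
  u != 0 -> w != 0 -> all (fun z => z != 0) zs ->
  (forall f1 f2, \sum_(c : bool) \sum_(d : bool) rmat u w f1 f2 c d * k1 c d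
     = k2 f1 f2) ->
  \sum_(c : bool) \sum_(d : bool) rmat u w e1 e2 c d * hline2 u w zs c d t bs k1
  = hline2 w u zs e1 e2 t bs k2.
Proof.
move=> u0 w0 + k12; elim: zs e1 e2 t bs => [|z zs IH] e1 e2 t bs /=.
  by move=> _; rewrite k12.
case/andP=> z0 zs0; case: t => [|n t]; first by rewrite !big_bool /=; ring.
case: bs => [|s bs]; first by rewrite !big_bool /=; ring.
transitivity (\sum_(f1 : bool) \sum_(f2 : bool) (\sum_(c : bool) \sum_(d : bool)
    rmat u w e1 e2 c d * col_pair u w z n s c d f1 f2)
    * hline2 u w zs f1 f2 t bs k1).
  by rewrite !big_bool /=; ring.
under [LHS]eq_bigr => f1 _ do under eq_bigr => f2 _ do
  rewrite (ybe_rows _ _ _ _ _ _ u0 w0 z0).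
under [RHS]eq_bigr => f1 _ do under eq_bigr => f2 _ do rewrite -IH //.
by rewrite !big_bool /=; ring.
Qed.

Lemma hline2_sum u w zs e1 e2 t bs (c : bool -> bool -> K) k :
  hline2 u w zs e1 e2 t bs
    (fun f1 f2 => \sum_(a : bool) \sum_(b : bool) c a b * k a b f1 f2) =
  \sum_(a : bool) \sum_(b : bool) c a b * hline2 u w zs e1 e2 t bs (k a b).
Proof.
elim: zs e1 e2 t bs => //= z zs IH e1 e2 [|n t] [|s bs];
  try by rewrite !big_bool /=; ring.
under eq_bigr => f1 _ do under eq_bigr => f2 _ do rewrite IH.
by rewrite !big_bool /=; ring.
Qed.

(** The edges between the two rows are summed column by column. The upper row crosses one more
    column, of parameter [w], which ends at the right corner of the lower row; that vertex and the
    two corners make up [right_pair]. *)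
Lemma hline_hline2 u w zs e1 e2 t (a b : bool) bs :
  size t = size zs -> size bs = size zs ->
  sum_bits (size zs).+1 (fun g =>
    hline u (rcons zs w) e1 (t ++ [:: a; b]) g (right_end u) *
    hline w zs e2 g bs (right_end w)) =
  hline2 u w zs e1 e2 t bs (right_pair u w a b).
Proof.
elim: zs e1 e2 t bs => [|z zs IH] e1 e2 [|n t] [|s bs] //=.
  move=> _ _; rewrite /right_pair /right_end.
  by rewrite sum_bitsS /sum_bits !big_bool /=; ring.
move=> [st] [sb].
under [RHS]eq_bigr => f1 _ do under eq_bigr => f2 _ do rewrite -IH // -sum_bitsZ.
under [RHS]eq_bigr => f1 _ do rewrite -sum_bits_sum.
rewrite -[RHS]sum_bits_sum.
rewrite sum_bitsS -[LHS]sum_bits_sum.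
apply: eq_sum_bits => g _.
by rewrite /col_pair /= !big_bool /=; ring.
Qed.

Lemma row_weight_pair u w zs (t1 t2 : bool) t (t3 t4 : bool) bs :
  size t = size zs -> size bs = size zs ->
  sum_bits (size zs).+2 (fun g =>
    row_weight u (w :: rcons zs w) [:: t1, t2 & t ++ [:: t3; t4]] g *
    row_weight w zs g bs) =
  \sum_(e1 : bool) \sum_(e2 : bool) left_pair u w t1 t2 e1 e2 *
    hline2 u w zs e1 e2 t bs (right_pair u w t3 t4).
Proof.
move=> st sb.
under [RHS]eq_bigr => f1 _ do under eq_bigr => f2 _ do
  rewrite -hline_hline2 // -sum_bitsZ.
under [RHS]eq_bigr => f1 _ do rewrite -sum_bits_sum.
rewrite -[RHS]sum_bits_sum.
rewrite sum_bitsS -[LHS]sum_bits_sum.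
apply: eq_sum_bits => g _.
by rewrite /row_weight /left_pair !big_bool /= !big_bool /=; ring.
Qed.

(** The R-matrix enters through the first two top edges, is turned into the rows by the left
    reflection equation, runs along them by the Yang-Baxter equation and is turned up by the right
    reflection equation, leaving through the last two top edges. *)
Lemma row_op_pair_rmat u w zs F t :
  u != 0 -> w != 0 -> all (fun z => z != 0) zs -> size t = (size zs).+4 ->
  rmat_at u w 0 (row_op u (w :: rcons zs w) (row_op w zs F)) t =
  rmat_at u w (size zs).+2 (row_op w (u :: rcons zs u) (row_op u zs F)) t.
Proof.
move=> u0 w0 zs0 st.
have rowE (x y : K) (t1 t2 : bool) t' (t3 t4 : bool) : size t' = size zs ->
    row_op x (y :: rcons zs y) (row_op y zs F) [:: t1, t2 & t' ++ [:: t3; t4]] =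
    sum_bits (size zs) (fun bs =>
      (\sum_(e1 : bool) \sum_(e2 : bool) left_pair x y t1 t2 e1 e2 *
       hline2 x y zs e1 e2 t' bs (right_pair x y t3 t4)) * F bs).
  move=> st'; rewrite /row_op.
  under eq_sum_bits => g _ do rewrite -sum_bitsZ.
  rewrite exchange_sum_bits; apply: eq_sum_bits => bs sb.
  rewrite -row_weight_pair // -sum_bitsZr [size (_ :: _)]/= size_rcons.
  by apply: eq_sum_bits => g _; ring.
case: t st => // t1 [|t2 t] //= [st].
have [t' [t3 [t4 [t5 [-> st' st5]]]]] := @split_bits (size zs) 0 t ltac:(lia).
case: t5 st5 => // _.
rewrite [LHS]/(rmat_at u w 0 _ _) /= -/(([:: t1, t2 & t']) ++ [:: t3, t4 & [::]]).
rewrite rmat_at_cat /= ?st' //.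
under [LHS]eq_bigr => c _ do under eq_bigr => d _ do rewrite rowE // -sum_bitsZ.
under [LHS]eq_bigr => c _ do rewrite -sum_bits_sum.
rewrite -[LHS]sum_bits_sum.
under [RHS]eq_bigr => c _ do under eq_bigr => d _ do rewrite rowE // -sum_bitsZ.
under [RHS]eq_bigr => c _ do rewrite -sum_bits_sum.
rewrite -[RHS]sum_bits_sum.
apply: eq_sum_bits => bs _.
transitivity (\sum_(e1 : bool) \sum_(e2 : bool) (\sum_(c : bool) \sum_(d : bool)
    rmat u w t1 t2 c d * left_pair u w c d e1 e2) *
    hline2 u w zs e1 e2 t' bs (right_pair u w t3 t4) * F bs).
  by rewrite !big_bool /=; ring.
under [LHS]eq_bigr => e1 _ do under eq_bigr => e2 _ do
  rewrite (reflection_left _ _ _ _ u0 w0).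
transitivity (\sum_(e1 : bool) \sum_(e2 : bool) left_pair w u t1 t2 e1 e2 *
   (\sum_(c : bool) \sum_(d : bool) rmat u w e1 e2 c d *
     hline2 u w zs c d t' bs (right_pair u w t3 t4)) * F bs).
  by rewrite !big_bool /=; ring.
under [LHS]eq_bigr => e1 _ do under eq_bigr => e2 _ do
  rewrite (hline2_rmat _ _ _ _ u0 w0 zs0
     (fun f1 f2 => reflection_right t3 t4 f1 f2 u0 w0)) hline2_sum.
by rewrite !big_bool /=; ring.
Qed.

(** The rows [us1] above the pair are crossed twice: the R-matrix descends through them along the
    left columns of [u] and [w] and comes back up along the right ones. *)
Lemma Zrec_exchange us1 us2 u w t :
  v != 0 -> all (fun z => z != 0) (us1 ++ u :: w :: us2) ->
  size t = (2 * (size us1 + size us2) + 5)%N ->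
  rmat_at u w (size us1) (Zrec (us1 ++ u :: w :: us2)) t =
  rmat_at u w (size us1 + 2 * size us2 + 3) (Zrec (us1 ++ w :: u :: us2)) t.
Proof.
move=> v0; elim: us1 t => [|x us1 IH] t /=.
  case/and3P=> u0 w0 us0 st.
  rewrite !rev_cons -!rcons_cons -!rcons_cat.
  have sz : size (us2 ++ v :: rev us2) = (2 * size us2).+1.
    by rewrite size_cat /= size_rev; lia.
  have -> : (0 + 2 * size us2 + 3)%N = (size (us2 ++ v :: rev us2)).+2 by lia.
  apply: row_op_pair_rmat => //; first by rewrite all_cat /= v0 all_rev us0.
  by rewrite st sz; lia.
case/andP=> x0 us0 st.
have /= /and3P[u0 w0 _] : all (fun z => z != 0) (u :: w :: us2).
  by move: us0; rewrite all_cat => /andP[].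
have zsE a b : (us1 ++ [:: a, b & us2]) ++ v :: rev (us1 ++ [:: a, b & us2]) =
   us1 ++ a :: b :: us2 ++ v :: rev us2 ++ b :: a :: rev us1.
  by rewrite -catA rev_cat !rev_cons -!cats1 -!catA.
rewrite !zsE row_op_rmat //; last first.
  by rewrite st ?size_cat /= ?size_cat /= ?size_cat /= ?size_rev /=; lia.
(* Only the left columns of the row [x] have been exchanged so far; the right ones follow when the
   R-matrix comes back up. *)
transitivity (row_op x (us1 ++ [:: w, u & us2 ++ v :: rev us2 ++ [:: w, u & rev us1]])
   (rmat_at u w (size us1 + 2 * size us2 + 3) (Zrec (us1 ++ [:: w, u & us2]))) t).
  apply: row_op_ext => bs sb; apply: IH => //.
  by rewrite sb ?size_cat /= ?size_cat /= ?size_cat /= ?size_rev /=; lia.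
pose zs1 := us1 ++ [:: w, u & us2 ++ v :: rev us2].
have zs1E a b : us1 ++ [:: w, u & us2 ++ v :: rev us2 ++ [:: a, b & rev us1]] =
   zs1 ++ a :: b :: rev us1 by rewrite /zs1 -!catA /= -!catA.
have szs1 : size zs1 = (size us1 + 2 * size us2 + 3)%N.
  by rewrite /zs1 ?size_cat /= ?size_cat /= ?size_cat /= ?size_rev /=; lia.
rewrite !zs1E -szs1 addSn -addSn.
rewrite -row_op_rmat //; last by rewrite st szs1 size_rev; lia.
by congr rmat_at; rewrite szs1; lia.
Qed.

Definition Zup us : K := Zrec us (nseq (2 * size us).+1 true).

Lemma rmat_at_up u w k F m : (k.+1 < m)%N ->
  rmat_at u w k F (nseq m true) = sigma (q ^+ 4 * w / u) * F (nseq m true).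
Proof.
move=> km; have mE : m = (k + (m - k).-2.+2)%N by lia.
rewrite mE nseqD /= rmat_at_cat ?size_nseq // !big_bool /rmat /=; ring.
Qed.

(* The R-matrix acts by a scalar on two edges that point up. *)
Lemma Zup_move us1 us2 us3 u :
  v != 0 -> all (fun z => z != 0) (us1 ++ u :: us2 ++ us3) ->
  all (fun w => sigma (q ^+ 4 * w / u) != 0) us2 ->
  Zup (us1 ++ u :: us2 ++ us3) = Zup (us1 ++ us2 ++ u :: us3).
Proof.
move=> v0; elim: us2 us1 => //= w us2 IH us1 us0 /andP[uw us2u].
have szE : size (us1 ++ [:: w, u & us2 ++ us3]) = size (us1 ++ [:: u, w & us2 ++ us3]).
  by rewrite !size_cat.
transitivity (Zup (us1 ++ w :: u :: us2 ++ us3)).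
  apply: (mulfI uw); rewrite /Zup szE.
  have sz : ((2 * size (us1 ++ [:: u, w & us2 ++ us3])).+1 =
     2 * (size us1 + size (us2 ++ us3)) + 5)%N by rewrite size_cat /=; lia.
  rewrite -!(@rmat_at_up u w (size us1)) ?sz; try lia.
  rewrite Zrec_exchange ?size_nseq // !rmat_at_up //; lia.
rewrite -cat1s catA IH // -?catA //.
by move: us0; rewrite !all_cat /= => /and4P[-> -> -> ->].
Qed.

End Exchange.

(** * Frozen rows *)

Section Recursion.
Variables (K : fieldType) (q p : K).
Implicit Types (u w z : K) (zs us : seq K) (e f : bool) (bs : seq bool).

Local Notation hline := (hline q).
Local Notation row_weight := (row_weight q p).
Local Notation row_op := (row_op q p).
Local Notation Zrec := (Zrec q p p).
Local Notation Zup := (Zup q p p).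
Local Notation right_end := (right_end q p).
Local Notation lw := (left_weight q p).
Local Notation rw := (right_weight q p).
Local Notation aw x := (sigma (q ^+ 2 * x) / sigma (q ^+ 4)).
Local Notation bw x := (sigma (q ^+ 2 * x^-1) / sigma (q ^+ 4)).
Local Notation up zs := (nseq (size zs) true).

Lemma sigma1 : sigma (1 : K) = 0.
Proof. by rewrite /sigma invr1 subrr. Qed.

Lemma sigmaV (x : K) : sigma x^-1 = - sigma x.
Proof. by rewrite /sigma invrK opprB. Qed.

Lemma sum_bitsD m (F G : seq bool -> K) :
  sum_bits m (fun s => F s + G s) = sum_bits m F + sum_bits m G.
Proof.
elim: m F G => //= m IH F G; rewrite -big_split.
by apply: eq_bigr => b _; rewrite IH.
Qed.

(** When the upper and the left edge both point out of a vertex, the ice rule forces the lower edge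
    up and the right edge left, so a leftward row below upward edges is frozen. *)
Lemma sum_hline_left u zs m t k (F : seq bool -> K) :
  sum_bits (size zs + m) (fun bs => hline u zs false (up zs ++ t) bs k * F bs) =
  (\prod_(z <- zs) bw (u * z)) *
    sum_bits m (fun bs => k false t bs * F (up zs ++ bs)).
Proof.
elim: zs F => [|z zs IH] F /=; first by rewrite big_nil mul1r.
rewrite big_bool /= [X in X + _](eq_sum_bits (G := fun s => bw (u * z) *
  (hline u zs false (up zs ++ t) s k * F (true :: s)))); last first.
  by move=> s _ /=; rewrite big_bool /=; ring.
rewrite [X in _ + X](eq_sum_bits (G := fun=> 0)); last first.
  by move=> s _ /=; rewrite big_bool /=; ring.
by rewrite sum_bits0 addr0 sum_bitsZ IH big_cons mulrA.
Qed.

Lemma sum_hline_right u zs m t k (F : seq bool -> K) :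
  (forall bs, size bs = m -> k false t bs = 0) ->
  sum_bits (size zs + m) (fun bs => hline u zs true (up zs ++ t) bs k * F bs) =
  (\prod_(z <- zs) aw (u * z)) *
    sum_bits m (fun bs => k true t bs * F (up zs ++ bs)).
Proof.
move=> k0; elim: zs F => [|z zs IH] F /=; first by rewrite big_nil mul1r.
rewrite big_bool /= [X in X + _](eq_sum_bits (G := fun s => aw (u * z) *
  (hline u zs true (up zs ++ t) s k * F (true :: s)))); last first.
  by move=> s _ /=; rewrite big_bool /=; ring.
rewrite [X in _ + X](eq_sum_bits (G := fun s =>
  hline u zs false (up zs ++ t) s k * F (false :: s))); last first.
  by move=> s _ /=; rewrite big_bool /=; ring.
rewrite sum_hline_left (eq_sum_bits (m := m) (G := fun=> 0)); last first.
  by move=> s ss; rewrite k0 ?mul0r.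
by rewrite sum_bits0 mulr0 addr0 sum_bitsZ IH big_cons mulrA.
Qed.

Lemma sum_hline_left0 u zs t k (F : seq bool -> K) :
  sum_bits (size zs) (fun bs => hline u zs false (up zs ++ t) bs k * F bs) =
  (\prod_(z <- zs) bw (u * z)) * (k false t [::] * F (up zs)).
Proof. by have := sum_hline_left u zs 0 t k F; rewrite addn0 /= cats0. Qed.

Lemma sum_hline_right0 u zs t k (F : seq bool -> K) :
  k false t [::] = 0 ->
  sum_bits (size zs) (fun bs => hline u zs true (up zs ++ t) bs k * F bs) =
  (\prod_(z <- zs) aw (u * z)) * (k true t [::] * F (up zs)).
Proof.
move=> k0; have := @sum_hline_right u zs 0 t k F; rewrite addn0 /= cats0.
by apply; case.
Qed.

Lemma row_op_cons u zs l t (F : seq bool -> K) :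
  row_op u zs F (l :: t) =
  lw u l true *
    sum_bits (size zs) (fun bs => hline u zs true t bs (right_end u) * F bs) +
  lw u l false *
    sum_bits (size zs) (fun bs => hline u zs false t bs (right_end u) * F bs).
Proof.
rewrite -!sum_bitsZ -sum_bitsD; apply: eq_sum_bits => bs _.
by rewrite /row_weight big_bool /=; ring.
Qed.

Lemma Zrec_up us : Zrec us (up (us ++ p :: rev us)) = Zup us.
Proof.
rewrite /Zup size_cat /= size_rev.
by have -> : (size us + (size us).+1 = (2 * size us).+1)%N by lia.
Qed.

Lemma Zup_cons u us : let zs := us ++ p :: rev us in
  Zup (u :: us) = row_op u zs (Zrec us) (true :: up zs ++ [:: true]).
Proof.

move=> zs; have szs : size zs = (2 * size us).+1.
  by rewrite size_cat /= size_rev; lia.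
rewrite /Zup; have -> : (2 * size (u :: us)).+1 = (size zs + 1).+1.
  by rewrite szs /=; lia.
by rewrite -[[:: true]]/(nseq 1 true) -nseqD.
Qed.

Lemma hline_drop u zs e t bs k : size zs = size bs ->
  forall t', size t = size zs ->
  hline u zs e (t ++ t') bs k = hline u zs e t bs (fun f _ _ => k f t' [::]).
Proof.
move=> + t'; elim: zs e t bs => [|z zs IH] e [|n t] [|s bs] //= [sb] [st].
by apply: eq_bigr => f _; rewrite IH.
Qed.

Lemma hline_lin u zs e t bs c d k1 k2 :
  c * hline u zs e t bs k1 + d * hline u zs e t bs k2 =
  hline u zs e t bs (fun f t bs => c * k1 f t bs + d * k2 f t bs).
Proof.
elim: zs e t bs => [|z zs IH] e [|n t] [|s bs] //=; rewrite ?mulr0 ?addr0 //.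
by under [RHS]eq_bigr => f _ do rewrite -IH; rewrite !big_bool /=; ring.
Qed.

(** Two rows that differ only in the edge above the right corner are merged into one whose right end
    is a linear combination of corner weights; a cancellation between them then appears as a zero of
    [k]. *)
Lemma row_op_right_lin u zs l r r' c d (F : seq bool -> K) :
  let k f (_ _ : seq bool) := c * rw u r (~~ f) + d * rw u r' (~~ f) in
  c * row_op u zs F (l :: up zs ++ [:: r]) +
  d * row_op u zs F (l :: up zs ++ [:: r']) =
  lw u l true *
    sum_bits (size zs) (fun bs => hline u zs true (up zs ++ [::]) bs k * F bs) +
  lw u l false *
    sum_bits (size zs) (fun bs => hline u zs false (up zs ++ [::]) bs k * F bs).
Proof.
move=> k.
have H e : sum_bits (size zs) (fun bs => hline u zs e (up zs ++ [::]) bs k * F bs) =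
  c * sum_bits (size zs)
    (fun bs => hline u zs e (up zs ++ [:: r]) bs (right_end u) * F bs) +
  d * sum_bits (size zs)
    (fun bs => hline u zs e (up zs ++ [:: r']) bs (right_end u) * F bs).
  rewrite -!sum_bitsZ -sum_bitsD; apply: eq_sum_bits => bs sb.
  by rewrite cats0 !hline_drop ?size_nseq // -hline_lin; ring.
by rewrite !row_op_cons !H; ring.
Qed.

Hypothesis q_neq0 : q != 0.
Hypothesis p_neq0 : p != 0.
Hypothesis sq2_neq0 : sigma (q ^+ 2) != 0.
Hypothesis sq4_neq0 : sigma (q ^+ 4) != 0.

(* The innermost row has a common factor because the central column and the
   boundary carry the same parameter p. *)
Lemma Zrec_rcons_eq0 us u t : u != 0 ->
  sigma (q ^+ 2 * (u * p)) * sigma (q ^+ 2 * (u * p)^-1) = 0 ->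
  size t = (2 * size us + 3)%N -> Zrec (rcons us u) t = 0.
Proof.
move=> u0 AB0; elim: us t => [|x us IH] t st /=.
  (* In each of the three admissible patterns of the innermost row, the factors
     [sigma (q ^+ 2 * (u * p))] and [sigma (q ^+ 2 * (u * p)^-1)] both occur, one from a corner and
     the other from the central vertex or the opposite corner. *)
  have lE : sigma (p * q ^+ 2 * u) = sigma (q ^+ 2 * (u * p)) by congr sigma; ring.
  have rE : sigma (p^-1 * q ^+ 2 * u^-1) = sigma (q ^+ 2 * (u * p)^-1).
    by rewrite invfM; congr sigma; ring.
  rewrite /row_op /= big_bool /= mulr1 mulr0 addr0.
  case: t st => [|a [|b [|c [|? ?]]]] //= _.
  rewrite /row_weight !big_bool /= !big_bool /=.
  move/eqP: AB0; rewrite mulf_eq0 => /orP[] /eqP AB0;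
  case: a; case: b; case: c => /=; rewrite /right_end /= ?lE ?rE ?AB0; ring.
rewrite -[RHS](sum_bits0 K (size (rcons us u ++ p :: rev (rcons us u)))).
apply: eq_sum_bits => bs sb; rewrite IH ?mulr0 //.
by rewrite sb size_cat /= size_rev size_rcons; lia.
Qed.

(** The left corner cannot have two outgoing edges, so the first horizontal edge points left, which
    freezes the whole row. *)
Lemma Zup_cons_left u us : u != 0 -> sigma (q ^+ 2 * u ^+ 2) = 0 ->
  let zs := us ++ p :: rev us in
  Zup (u :: us) = lw u true false * (\prod_(z <- zs) bw (u * z)) *
    rw u true true * Zup us.
Proof.
move=> u0 su zs; rewrite Zup_cons -/zs row_op_cons /= su !mul0r add0r.
by rewrite sum_hline_left0 Zrec_up /= -!mulrA.
Qed.

(** The right corner cannot have two outgoing edges, so the row must reach it rightwards; starting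
    leftwards or turning on the way would prevent that. *)
Lemma Zup_cons_right u us : u != 0 -> sigma (q ^+ 2 * u^-1 ^+ 2) = 0 ->
  let zs := us ++ p :: rev us in
  Zup (u :: us) = lw u true true * (\prod_(z <- zs) aw (u * z)) *
    rw u true false * Zup us.
Proof.
move=> u0 su zs; rewrite Zup_cons -/zs row_op_cons.
rewrite sum_hline_left0 sum_hline_right0 /right_end /= su ?mul0r //.
by rewrite Zrec_up !(mul0r, mulr0) addr0 -!mulrA.
Qed.

(* The row of u is all right, or turns left in its last column; in the sum of
   the two terms the configurations where the row of w ends leftwards cancel. *)
Lemma Zup_cons2_right u w us : u != 0 -> w != 0 -> u * w = q ^+ 2 ->
  let zs := us ++ p :: rev us in
  Zup (u :: w :: us) =
    lw u true true * (\prod_(z <- zs) aw (u * z)) * lw w true true *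
    (\prod_(z <- zs) aw (w * z)) * (sigma (p^-1 * w) / sigma (q ^+ 2)) *
    rw w true false * Zup us.
Proof.
move=> u0 w0 uw zs.
have bw0 : bw (u * w) = 0 by rewrite uw divff ?expf_neq0 // sigma1 mul0r.
have aw1 : aw (u * w) = 1 by rewrite uw -exprD divff.
(* Since [u * w = q ^+ 2], the right corner weights of [u] are those of [w], one of them with the
   opposite sign; the cancellation rests on this sign. *)
have r1 : sigma (p^-1 * q ^+ 2 * u^-1) = sigma (p^-1 * w).
  by rewrite -uw; congr sigma; field; rewrite u0 p_neq0.
have r2 : sigma (q ^+ 2 * u^-1 ^+ 2) = - sigma (q ^+ 2 * w^-1 ^+ 2).
  by rewrite -sigmaV -uw; congr sigma; field; rewrite u0 w0.
have szs : size (us ++ p :: rev us) = (2 * size us).+1.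
  by rewrite size_cat /= size_rev; lia.
pose zs1 := w :: zs.
have zsE : (w :: us) ++ p :: rev (w :: us) = zs1 ++ [:: w].
  by rewrite /zs1 /zs rev_cons -cats1 /= -catA.
have prod0 : \prod_(z <- zs1 ++ [:: w]) bw (u * z) = 0.
  by rewrite big_cons bw0 mul0r.
rewrite Zup_cons zsE row_op_cons.
rewrite sum_hline_left0 prod0 !(mul0r, mulr0) addr0.
under eq_sum_bits => bs _ do rewrite hline_cat.
rewrite size_cat nseqD -catA sum_hline_right; last first.
  case=> // b [|? ?] // _; rewrite /= big_bool /right_end /=.
  by case: b; rewrite /= ?bw0; ring.
rewrite big_cons aw1 mul1r /= !big_bool /= ?big_bool /right_end /= aw1 r1 r2.
rewrite !mul1r !mul0r add0r addr0 row_op_right_lin.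
rewrite sum_hline_left0 sum_hline_right0 /=; last by ring.
rewrite -Zrec_up; ring.
Qed.

(** Mirror image of the previous reduction: the row of [u] is all left or turns in its first column,
    and the configurations where the row of [w] starts rightwards cancel. *)
Lemma Zup_cons2_left u w us : u != 0 -> w != 0 -> u * w * q ^+ 2 = 1 ->
  let zs := us ++ p :: rev us in
  Zup (u :: w :: us) =
    rw u true true * (\prod_(z <- zs) bw (u * z)) * rw w true true *
    (\prod_(z <- zs) bw (w * z)) * (sigma (p * w^-1) / sigma (q ^+ 2)) *
    lw w true false * Zup us.
Proof.
move=> u0 w0 uw zs.
have uE : u = (q ^+ 2 * w)^-1.
  apply: (mulIf (mulf_neq0 w0 (expf_neq0 2 q_neq0))); rewrite mulrA uw.
  by rewrite mulrC [w * _]mulrC divff // mulf_neq0 ?expf_neq0.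
have aw0 : aw (u * w) = 0 by rewrite [q ^+ 2 * _]mulrC uw sigma1 mul0r.
have bw1 : bw (u * w) = 1.
  have -> : (u * w)^-1 = q ^+ 2 by rewrite uE invfM invrK mulfK // -mulrA mulVf ?mulr1.
  by rewrite -exprD divff.
have l1 : sigma (p * q ^+ 2 * u) = sigma (p * w^-1).
  by rewrite uE; congr sigma; field; rewrite w0 q_neq0.
have l2 : sigma (q ^+ 2 * u ^+ 2) = - sigma (q ^+ 2 * w ^+ 2).
  by rewrite -sigmaV uE; congr sigma; field; rewrite q_neq0 w0.
pose zs1 := zs ++ [:: w].
have zsE : (w :: us) ++ p :: rev (w :: us) = w :: zs1.
  by rewrite /zs1 /zs rev_cons -cats1 /= -catA.
have S1 (F : seq bool -> K) : sum_bits (size (w :: zs1)) (fun bs =>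
    hline u (w :: zs1) true (up (w :: zs1) ++ [:: true]) bs (right_end u) * F bs) =
  (\prod_(z <- zs1) bw (u * z)) * (rw u true true * F (false :: up zs1)).
  rewrite [LHS]/= big_bool /= [X in X + _](eq_sum_bits (G := fun=> 0)); last first.
    by move=> s _; rewrite big_bool /= aw0; ring.
  rewrite sum_bits0 add0r (eq_sum_bits (G := fun s =>
    hline u zs1 false (up zs1 ++ [:: true]) s (right_end u) * F (false :: s))).
    by rewrite sum_hline_left0.
  by move=> s _; rewrite big_bool /=; ring.
rewrite Zup_cons zsE row_op_cons S1 sum_hline_left0 big_cons bw1 mul1r.
rewrite /right_end [lw u]lock [rw u]lock /= -!lock.
have upE : up zs1 = up zs ++ [:: true] by rewrite size_cat nseqD.
rewrite upE !row_op_cons !sum_hline_left0 /=.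
rewrite l1 l2.
have -> : \prod_(z <- zs1) bw (u * z) = \prod_(z <- zs) bw (u * z).
  by rewrite big_cat big_cons big_nil /= bw1 !mulr1.
by rewrite Zrec_up /right_end /=; ring.
Qed.

End Recursion.

(** * Degree in the first parameter *)

Section Laurent.
Variable K : fieldType.

(* Up to the factor u ^ d, f is a polynomial in u ^ 2. *)
Definition laurent (d : nat) (f : K -> K) :=
  exists2 P : {poly K}, (size P <= d.+1)%N &
    forall u, u != 0 -> u ^+ d * f u = P.[u ^+ 2].

Lemma eq_laurent d f g : (forall u, u != 0 -> f u = g u) ->
  laurent d f -> laurent d g.
Proof. by move=> fg [P sP Pf]; exists P => // u u0; rewrite -fg ?Pf. Qed.

Lemma laurentC c : laurent 0 (fun=> c).
Proof.
exists c%:P; first by rewrite size_polyC leq_b1.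
by move=> u _; rewrite expr0 mul1r hornerC.
Qed.

Lemma laurent0 d : laurent d (fun=> 0).
Proof. by exists 0 => [|u _]; rewrite ?size_poly0 // horner0 mulr0. Qed.

Lemma laurentD d f g : laurent d f -> laurent d g ->
  laurent d (fun u => f u + g u).
Proof.
move=> [P sP Pf] [Q sQ Qg]; exists (P + Q).
  by rewrite (leq_trans (size_polyD _ _)) // geq_max sP.
by move=> u u0; rewrite mulrDr Pf // Qg // hornerD.
Qed.

Lemma laurentM d1 d2 f g : laurent d1 f -> laurent d2 g ->
  laurent (d1 + d2) (fun u => f u * g u).
Proof.
move=> [P sP Pf] [Q sQ Qg]; exists (P * Q).
  by rewrite (leq_trans (size_polyMleq _ _)) //; lia.
by move=> u u0; rewrite hornerM -Pf // -Qg // exprD mulrACA.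
Qed.

Lemma laurentS2 d f : laurent d f -> laurent d.+2 f.
Proof.
move=> [P sP Pf]; exists ('X * P).
  by rewrite (leq_trans (size_polyMleq _ _)) // size_polyX; lia.
by move=> u u0; rewrite hornerM hornerX -Pf // mulrA -exprD.
Qed.

Lemma laurent_sum_bits d m (f : K -> seq bool -> K) :
  (forall s, size s = m -> laurent d (f^~ s)) ->
  laurent d (fun u => sum_bits m (f u)).
Proof.
elim: m f => [|m IH] f Lf /=; first exact: Lf.
apply: (@eq_laurent _ (fun u => sum_bits m (fun s => f u (true :: s)) +
  sum_bits m (fun s => f u (false :: s)))) => [u _|].
  by rewrite big_bool.
by apply: laurentD; apply: (IH (fun u s => f u (_ :: s))) => s ss;
  apply: Lf; rewrite /= ss.
Qed.

Lemma laurent_sigma c : c != 0 -> laurent 1 (fun u => sigma (c * u)).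
Proof.
move=> c0; exists (c *: 'X - (c^-1)%:P).
  by rewrite (leq_trans (size_polyD _ _)) // geq_max size_polyN size_polyC
    (leq_trans (size_scale_leq _ _)) ?size_polyX // (leq_trans (leq_b1 _)).
move=> u u0; rewrite !hornerE /sigma /=; field; rewrite u0 ?c0 ?andbT //.
Qed.

Lemma laurent_sigmaV c : c != 0 -> laurent 1 (fun u => sigma (c * u^-1)).
Proof.
move=> c0; exists (c%:P - c^-1 *: 'X).
  by rewrite (leq_trans (size_polyD _ _)) // geq_max size_polyN size_polyC
    (leq_trans (size_scale_leq _ _)) ?size_polyX // (leq_trans (leq_b1 _)).
move=> u u0; rewrite !hornerE /sigma /=; field; rewrite u0 ?c0 ?andbT //.
Qed.

Lemma laurent_sigma2 c : c != 0 -> laurent 2 (fun u => sigma (c * u ^+ 2)).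
Proof.
move=> c0; exists (c *: 'X^2 - (c^-1)%:P).
  by rewrite (leq_trans (size_polyD _ _)) // geq_max size_polyN size_polyC
    (leq_trans (size_scale_leq _ _)) ?size_polyXn // (leq_trans (leq_b1 _)).
move=> u u0; rewrite !hornerE /sigma /=; field; rewrite u0 ?c0 ?andbT //.
Qed.

Lemma laurent_sigmaV2 c : c != 0 -> laurent 2 (fun u => sigma (c * u^-1 ^+ 2)).
Proof.
move=> c0; exists (c%:P - c^-1 *: 'X^2).
  by rewrite (leq_trans (size_polyD _ _)) // geq_max size_polyN size_polyC
    (leq_trans (size_scale_leq _ _)) ?size_polyXn // (leq_trans (leq_b1 _)).
move=> u u0; rewrite !hornerE /sigma /=; field; rewrite u0 ?c0 ?andbT //.
Qed.

Variables q p : K.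
Hypothesis q_neq0 : q != 0.
Hypothesis p_neq0 : p != 0.

Implicit Types (u w z : K) (zs us : seq K) (e f : bool) (bs : seq bool).

Lemma laurentZr d (f : K -> K) c : laurent d f -> laurent d (fun u => f u * c).
Proof. by move=> Lf; rewrite -[d]addn0; apply: laurentM (laurentC _). Qed.

(** A vertex where the horizontal direction changes has weight 1 or 0, hence degree 0; otherwise the
    degree is 1. *)
Lemma laurent_bulk z n s e f : z != 0 ->
  laurent (e == f) (fun u => bulk_weight q (u * z) n s e f).
Proof.
move=> z0.
have La : laurent 1 (fun u => sigma (q ^+ 2 * (u * z)) / sigma (q ^+ 4)).
  apply: laurentZr; apply: eq_laurent (@laurent_sigma (q ^+ 2 * z) _).
    by move=> u _; congr sigma; ring.
  by rewrite mulf_neq0 ?expf_neq0.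
have Lb : laurent 1 (fun u => sigma (q ^+ 2 * (u * z)^-1) / sigma (q ^+ 4)).
  apply: laurentZr; apply: eq_laurent (@laurent_sigmaV (q ^+ 2 * z^-1) _).
    by move=> u _; rewrite invfM; congr sigma; ring.
  by rewrite mulf_neq0 ?expf_neq0 ?invr_eq0.
by case: n; case: s; case: e; case: f => //=; exact: laurent0 || exact: laurentC.
Qed.

Lemma laurent_right e :
  laurent (~~ e).+1 (fun u => right_weight q p u true (~~ e)).
Proof.
case: e => /=; apply: laurentZr.
  by apply: laurent_sigmaV; rewrite mulf_neq0 ?invr_eq0 ?expf_neq0.
by apply: laurent_sigmaV2; rewrite expf_neq0.
Qed.

Lemma laurent_left e : laurent e.+1 (fun u => left_weight q p u true e).
Proof.
case: e => /=; apply: laurentZr.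
  by apply: laurent_sigma2; rewrite expf_neq0.
by apply: laurent_sigma; rewrite mulf_neq0 ?expf_neq0.
Qed.

(** A turn saves one degree, while the right corner costs 2 instead of 1 if it is reached leftwards.
    So the bound depends on the initial direction; it is attained with the right parity except after
    a turn from left to right, where it has to be raised by two. *)
Lemma laurent_hline zs e t bs : all (fun z => z != 0) zs -> size t = size zs ->
  laurent (size zs + (~~ e).+1)
    (fun u => hline q u zs e (t ++ [:: true]) bs (right_end q p u)).
Proof.
elim: zs e t bs => [|z zs IH] e [|n t] bs //=.
  move=> _ _; rewrite /right_end; case: bs => [|? ?]; last exact: laurent0.
  exact: laurent_right.
case/andP=> z0 zs0 [st]; case: bs => [|s bs]; first exact: laurent0.
apply: (@eq_laurent _ (fun u =>
  bulk_weight q (u * z) n s e e *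
    hline q u zs e (t ++ [:: true]) bs (right_end q p u) +
  bulk_weight q (u * z) n s e (~~ e) *
    hline q u zs (~~ e) (t ++ [:: true]) bs (right_end q p u))).
  by move=> u _; rewrite big_bool; case: (e) => //=; rewrite addrC.
apply: laurentD.
  have := laurentM (laurent_bulk n s e e z0) (IH e t bs zs0 st).
  by rewrite eqxx.
have := laurentM (laurent_bulk n s e (~~ e) z0) (IH (~~ e) t bs zs0 st).
case: e => /=; first by rewrite !addnS.
by move/laurentS2; rewrite !addnS.
Qed.

Lemma laurent_Zup us : all (fun z => z != 0) us ->
  laurent (2 * size us + 4) (fun u => Zup q p p (u :: us)).
Proof.
move=> us0; pose zs := us ++ p :: rev us.
have szs : size zs = (2 * size us).+1 by rewrite size_cat /= size_rev; lia.
have zs0 : all (fun z => z != 0) zs by rewrite all_cat /= p_neq0 all_rev us0.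
apply: (@eq_laurent _ (fun u => left_weight q p u true true *
    sum_bits (size zs) (fun bs => hline q u zs true
      (nseq (size zs) true ++ [:: true]) bs (right_end q p u) * Zrec q p p us bs) +
    left_weight q p u true false *
    sum_bits (size zs) (fun bs => hline q u zs false
      (nseq (size zs) true ++ [:: true]) bs (right_end q p u) * Zrec q p p us bs))).
  by move=> u _; rewrite Zup_cons -/zs row_op_cons.
apply: laurentD.
  have -> : (2 * size us + 4 = 2 + (size zs + 1))%N by lia.
  apply: laurentM (laurent_left true) _; apply: laurent_sum_bits => s _.
  by apply: laurentZr; apply: (@laurent_hline zs true); rewrite ?size_nseq.
have -> : (2 * size us + 4 = 1 + (size zs + 2))%N by lia.
apply: laurentM (laurent_left false) _; apply: laurent_sum_bits => s _.
by apply: laurentZr; apply: (@laurent_hline zs false); rewrite ?size_nseq.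
Qed.

End Laurent.

(** * Bialternants *)

Section DetFun.
Variable R : comNzRingType.

(** Entries are indexed by natural numbers, so that rows and columns can be shifted without casts
    between ordinal types. *)
Definition det_fun m (f : nat -> nat -> R) : R := \det (\matrix_(i < m, j < m) f i j).

Lemma eq_det_fun m f g : (forall i j, (i < m)%N -> (j < m)%N -> f i j = g i j) ->
  det_fun m f = det_fun m g.
Proof. by move=> fg; congr (\det _); apply/matrixP => i j; rewrite !mxE fg. Qed.

Lemma det_fun_lblock m f :
  (forall j, f 0%N j.+2 = 0) -> (forall j, f 1%N j.+2 = 0) ->
  det_fun m.+2 f = (f 0%N 0%N * f 1%N 1%N - f 0%N 1%N * f 1%N 0%N) *
    det_fun m (fun i j => f i.+2 j.+2).
Proof.
move=> f0 f1; rewrite /det_fun -[m.+2]/(2 + m)%N.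
set M := \matrix_(i, j) _.
have -> : M = block_mx (ulsubmx M) 0 (dlsubmx M) (drsubmx M).
  rewrite -[LHS]submxK; congr block_mx; apply/matrixP => i j.
  by rewrite !mxE /=; case: i => [[|[|i]] ?] //=; rewrite ?f0 ?f1.
rewrite det_lblock; congr (_ * _).
  rewrite (expand_det_row _ 0) !big_ord_recl big_ord0 addr0 /cofactor.
  by rewrite !det_mx11 !mxE /= expr0 expr1; ring.
by congr (\det _); apply/matrixP => i j; rewrite !mxE.
Qed.

Lemma det_fun_scale m c f :
  det_fun m (fun i j => c i * f i j) = (\prod_(i < m) c i) * det_fun m f.
Proof.
pose d : 'rV[R]_m := \row_i c i.
have -> : \prod_(i < m) c i = \det (diag_mx d).
  by rewrite det_diag; apply: eq_bigr => i _; rewrite mxE.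
rewrite /det_fun -det_mulmx; congr (\det _); apply/matrixP => i j.
by rewrite mul_diag_mx !mxE.
Qed.

Definition set_row (f : nat -> nat -> R) k (g : nat -> R) i j :=
  if i == k then g j else f i j.

Lemma det_fun_row_lin m k f g h a b : (k < m)%N ->
  det_fun m (set_row f k (fun j => a * g j + b * h j)) =
  a * det_fun m (set_row f k g) + b * det_fun m (set_row f k h).
Proof.
move=> km; apply: (determinant_multilinear (i0 := Ordinal km)).
- by apply/rowP => j; rewrite !mxE /set_row /= eqxx.
- by apply/matrixP => i j; rewrite !mxE /set_row eq_sym (negPf (neq_bump _ _)).
- by apply/matrixP => i j; rewrite !mxE /set_row eq_sym (negPf (neq_bump _ _)).
Qed.

Lemma det_fun_alternate m k l f : (k < m)%N -> (l < m)%N -> k != l ->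
  (forall j, f k j = f l j) -> det_fun m f = 0.
Proof.
move=> km lm kl fkl.
apply: (@determinant_alternate _ _ _ (Ordinal km) (Ordinal lm)) => //.
by move=> j; rewrite !mxE fkl.
Qed.

Lemma det_fun_row_sub m k l f c : (k < m)%N -> (l < m)%N -> k != l ->
  det_fun m (set_row f k (fun j => f k j - c * f l j)) = det_fun m f.
Proof.
move=> km lm kl.
rewrite (@eq_det_fun _ _ (set_row f k (fun j => 1 * f k j + - c * f l j))).
  rewrite det_fun_row_lin // mul1r (@det_fun_alternate _ k l (set_row f k (f l))) //.
    rewrite mulr0 addr0; apply: eq_det_fun => i j _ _.
    by rewrite /set_row; case: eqP => // ->.
  by move=> j; rewrite /set_row eqxx eq_sym (negPf kl).
by move=> i j _ _; rewrite /set_row mul1r mulNr.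
Qed.

(** All columns are changed at once by multiples of the original ones, which is multiplication by a
    unitriangular matrix. *)
Lemma det_fun_col_shift m f c :
  det_fun m (fun i j => f i j - (if j is j'.+2 then c * f i j' else 0)) =
  det_fun m f.
Proof.
pose U : 'M[R]_m := \matrix_(i, j) ((i == j)%:R - (j == i.+2 :> nat)%:R * c).
have dU : \det U = 1.
  rewrite -det_tr det_trig.
    by apply: big1 => i _; rewrite !mxE eqxx ltn_eqF ?subr0 ?mul0r ?subr0.
  apply/is_trig_mxP => i j ij; rewrite !mxE -val_eqE /= gtn_eqF // ltn_eqF; last lia.
  by rewrite mul0r subr0.
rewrite -[RHS]mulr1 -dU /det_fun -det_mulmx; congr (\det _).
apply/matrixP => i j; rewrite !mxE.
under eq_bigr => k _ do rewrite !mxE mulrBr.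
rewrite sumrB (bigD1 j) //= eqxx mulr1 big1 ?addr0; last first.
  by move=> k kj; rewrite (negPf kj) mulr0.
congr (_ - _).
have big0 : (forall k : 'I_m, (j == k.+2 :> nat) = false) ->
   0 = \sum_(k < m) f i k * ((j == k.+2 :> nat)%:R * c).
  by move=> jk; rewrite big1 // => k _; rewrite jk mul0r mulr0.
case: j big0 => [[|[|j]] jm] big0 /=; try by apply: big0.
have jm' : (j < m)%N by lia.
rewrite (bigD1 (Ordinal jm')) //= eqxx mul1r mulrC big1 ?addr0 // => k kj.
rewrite eqSS eqSS [_ == _](_ : _ = false) ?mul0r ?mulr0 //.
by apply/negbTE; move: kj; rewrite -val_eqE /= eq_sym.
Qed.

End DetFun.

Lemma det_fun_horner (K : fieldType) m (f : nat -> nat -> {poly K}) x :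
  (det_fun m f).[x] = det_fun m (fun i j => (f i j).[x]).
Proof.
rewrite /det_fun -[LHS]/(horner_eval x _) -det_map_mx.
by congr (\det _); apply/matrixP => i j; rewrite !mxE.
Qed.

(** * Exponents of the double staircase *)

Section Exponents.
Local Open Scope nat_scope.

(** For j < 2 n these are, in decreasing order, the numbers below 3 n that are not 1 modulo 3. *)
Definition stair_exp n j := nth 0 (double_staircase n) j + (2 * n - j.+1).

Lemma nth_double_staircase n j : nth 0 (double_staircase n) j = n - uphalf j.
Proof.
pose D m := flatten [seq [:: k; k] | k <- rev (iota 1 m)].
have DS m : D m.+1 = [:: m.+1, m.+1 & D m].
  by rewrite /D -[in iota _ _](addn1 m) iotaD rev_cat /= add1n.
have nthD m i : nth 0 (D m) i = m - i./2.
  elim: m i => [|m IH] i; first by rewrite nth_nil.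
  by rewrite DS; case: i => [|[|i]] //=; rewrite IH.
case: j => [|j]; first by rewrite subn0.
by rewrite [LHS]nthD uphalfE /=; lia.
Qed.

Lemma stair_expE n j : stair_exp n j = n - uphalf j + (2 * n - j.+1).
Proof. by rewrite /stair_exp nth_double_staircase. Qed.

Lemma stair_exp0 n : stair_exp n.+1 0 = 3 * n + 2.
Proof. by rewrite stair_expE /=; lia. Qed.

Lemma stair_exp1 n : stair_exp n.+1 1 = 3 * n.
Proof. by rewrite stair_expE /=; lia. Qed.

Lemma stair_expSS n j : stair_exp n.+1 j.+2 = stair_exp n j.
Proof. by rewrite !stair_expE /=; lia. Qed.

Lemma stair_exp_shift n j : j.+2 < 2 * n -> stair_exp n j = stair_exp n j.+2 + 3.
Proof. by rewrite !stair_expE /= => jn; lia. Qed.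

Lemma stair_exp_leq n j : stair_exp n.+1 j <= 3 * n + 2.
Proof. by rewrite stair_expE; lia. Qed.

End Exponents.

(** * The Schur function of the double staircase as a quotient of alternants *)

Section Schur.
Variable K : fieldType.
Implicit Types (xs ys : seq K).

Definition vdm m xs : K :=
  \prod_(i < m) \prod_(j < m | (i < j)%N) (xs`_i - xs`_j).

Definition alternant n xs : K :=
  det_fun (2 * n) (fun i j => xs`_i ^+ stair_exp n j).

Definition staircase_schur n xs : K := alternant n xs / vdm (2 * n) xs.

Lemma vdm_cons m x ys : size ys = m ->
  vdm m.+1 (x :: ys) = (\prod_(y <- ys) (x - y)) * vdm m ys.
Proof.
move=> sy; rewrite /vdm big_ord_recl /=; congr (_ * _).
  by rewrite big_mkcond big_ord_recl /= mul1r (big_nth 0) sy big_mkord.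
apply: eq_bigr => i _; rewrite big_mkcond big_ord_recl /= mul1r [RHS]big_mkcond.
by apply: eq_bigr => j _.
Qed.

(** One permutation serves the Vandermonde product and every alternant, so its sign cancels in their
    quotient. *)
Lemma vdm_perm m xs ys : size ys = m -> perm_eq xs ys ->
  exists s : 'S_m, [/\ vdm m xs = (-1) ^+ s * vdm m ys &
    forall f : nat -> K -> K, det_fun m (fun i j => f j xs`_i) =
      (-1) ^+ s * det_fun m (fun i j => f j ys`_i)].
Proof.
move=> /eqP sy; rewrite -[ys]/(val (Tuple sy)) => /tuple_permP[s xsE].
have xsi (i : 'I_m) : xs`_i = ys`_(s i).
  by rewrite xsE -[LHS](tnth_nth 0) tnth_mktuple (tnth_nth 0).
have det_perm (f : nat -> K -> K) : det_fun m (fun i j => f j xs`_i) =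
    (-1) ^+ s * det_fun m (fun i j => f j ys`_i).
  rewrite /det_fun -det_perm -det_mulmx -row_permE; congr (\det _).
  by apply/matrixP => i j; rewrite !mxE xsi.
exists s; split=> //.
(* [c] is the sign between the factors x_i - x_j used here and x_j - x_i in the Vandermonde
   determinant. *)
pose c : K := \prod_(i < m) \prod_(j < m | (i < j)%N) -1.
have vdmE zs : vdm m zs = c * det_fun m (fun i j => zs`_i ^+ j).
  pose a : 'rV[K]_m := \row_i zs`_i.
  have -> : det_fun m (fun i j => zs`_i ^+ j) = \det (Vandermonde m a).
    by rewrite -det_tr; congr (\det _); apply/matrixP => i j; rewrite !mxE.
  rewrite det_Vandermonde /c -big_split; apply: eq_bigr => i _.
  rewrite -big_split; apply: eq_bigr => j _.
  by rewrite !mxE /= mulN1r opprB.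
by rewrite !vdmE (det_perm (fun j x => x ^+ j)) mulrCA.
Qed.

Lemma staircase_schur_perm n xs ys : size ys = (2 * n)%N -> perm_eq xs ys ->
  staircase_schur n xs = staircase_schur n ys.
Proof.
move=> sy /(vdm_perm sy)[s [v a]]; rewrite /staircase_schur v.
rewrite /alternant (a (fun j x => x ^+ stair_exp n j)).
by rewrite -mulf_div divff ?mul1r // signr_eq0.
Qed.

Lemma cube_root1 (w : K) : w ^+ 2 + w + 1 = 0 -> w ^+ 3 = 1.
Proof.
move=> w3; apply/eqP; rewrite -subr_eq0; apply/eqP.
by transitivity ((w - 1) * (w ^+ 2 + w + 1)); [ring | rewrite w3 mulr0].
Qed.

Lemma cube_root_exp (w : K) n j : w ^+ 2 + w + 1 = 0 -> (j < 2 * n)%N ->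
  w ^+ stair_exp n j = if odd j then 1 else w ^+ 2.
Proof.
move=> w3 jn.
have w31 := cube_root1 w3.
have -> : stair_exp n j = (3 * (n - j./2 - odd j) - (~~ odd j))%N.
  by rewrite stair_expE; lia.
case: (boolP (odd j)) => oj; first by rewrite subn0 exprM w31 expr1n.
have -> : (3 * (n - j./2 - false) - true = 3 * (n - j./2).-1 + 2)%N by lia.
by rewrite exprD exprM w31 expr1n mul1r.
Qed.

(* All exponents are 0 or 2 modulo 3, so subtracting r ^ -3 times the column of
   exponent e + 3 from that of exponent e kills the first two rows. *)
Lemma alternant_wheel n (w r : K) ys : w ^+ 2 + w + 1 = 0 -> r != 0 ->
  size ys = (2 * n)%N ->
  alternant n.+1 [:: w * r, r & ys] = (w ^+ 2 - 1) * r ^+ 2 *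
    (\prod_(y <- ys) ((r - y) * (w * r - y) * (w ^+ 2 * r - y))) *
    alternant n ys.
Proof.
move=> w3 r0 sy; rewrite /alternant.
rewrite -(det_fun_col_shift _ _ (r ^- 3)).
have -> : (2 * n.+1 = (2 * n).+2)%N by lia.
pose g i j := [:: w * r, r & ys]`_i ^+ stair_exp n.+1 j.
(* The lower right block is the alternant of order n with the row of y scaled by 1 - y ^ 3 / r ^ 3,
   which the cube roots of unity split into three linear factors. *)
rewrite (@eq_det_fun _ _ _ (fun i j =>
  if (i < 2)%N then (if (j < 2)%N then g i j else 0)
  else if (j < 2)%N then g i j
  else (1 - r ^- 3 * ys`_i.-2 ^+ 3) * ys`_i.-2 ^+ stair_exp n j.-2)).
  rewrite det_fun_lblock //= det_fun_scale /g /= !stair_exp0 !stair_exp1.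
  rewrite mulrA; congr (_ * _).
  rewrite [in RHS](big_nth 0) sy big_mkord.
  have -> : \prod_(i < 2 * n) (1 - r ^- 3 * ys`_i ^+ 3) = 
    r ^- (6 * n) * \prod_(i < 2 * n)
      ((r - ys`_i) * (w * r - ys`_i) * (w ^+ 2 * r - ys`_i)).
    rewrite (_ : r ^- (6 * n) = \prod_(i < 2 * n) r ^- 3); last first.
      by rewrite prodr_const card_ord exprVn -exprM; congr (r ^- _); lia.
    rewrite -big_split; apply: eq_bigr => i _ /=.
    set y := ys`_i.
    have -> : (r - y) * (w * r - y) * (w ^+ 2 * r - y) = r ^+ 3 - y ^+ 3 + 
       (w ^+ 2 + w + 1) * (r ^+ 3 * (w - 1) - y * r ^+ 2 * w + y ^+ 2 * r).
      ring.
    by rewrite w3 mul0r addr0 mulrBr mulVf ?expf_neq0.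
  rewrite mulrA; congr (_ * _).
  have w31 := cube_root1 w3.
  have wn : w ^+ (3 * n) = 1 by rewrite exprM w31 expr1n.
  have rn : r ^+ (6 * n) = r ^+ (3 * n) * r ^+ (3 * n).
    by rewrite -exprD; congr (_ ^+ _); clear; lia.
  have rn0 : r ^+ (3 * n) != 0 by rewrite expf_neq0.
  by rewrite rn !exprMn !(exprD _ (3 * n) 2) wn; field; rewrite rn0.
move=> i j im jm; case: j jm => [|[|j]] jm; rewrite ?subr0 /=; try by case: ifP.
rewrite -/(g i j) -/(g i j.+2).
have sE : stair_exp n.+1 j = (stair_exp n.+1 j.+2 + 3)%N.
  by apply: stair_exp_shift; lia.
case: i im => [|[|i]] im; rewrite /g /=.
- have wj : w ^+ stair_exp n.+1 j = w ^+ stair_exp n.+1 j.+2.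
    by rewrite !cube_root_exp //= ?negbK //; lia.
  by rewrite !exprMn wj sE exprD; field.
- by rewrite sE exprD mulrCA mulVf ?mulr1 ?subrr // expf_neq0.
- by rewrite sE exprD stair_expSS; ring.
Qed.

(** Of the three factors per [y] in the alternant, those at [r] and [w * r] cancel against the
    Vandermonde product; the one at the third cube root remains. *)
Lemma staircase_schur_wheel n (w r : K) ys :
  w ^+ 2 + w + 1 = 0 -> w != 1 -> r != 0 -> size ys = (2 * n)%N ->
  all (fun y => (r != y) && (w * r != y)) ys ->
  staircase_schur n.+1 [:: w * r, r & ys] =
  - (w ^+ 2 * r) * (\prod_(y <- ys) (w ^+ 2 * r - y)) * staircase_schur n ys.
Proof.
move=> w3 w1 r0 sy rys; rewrite /staircase_schur alternant_wheel //.
have -> : (2 * n.+1 = (2 * n).+2)%N by lia.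
rewrite vdm_cons /= ?sy // vdm_cons // big_cons.
have -> : \prod_(y <- ys) ((r - y) * (w * r - y) * (w ^+ 2 * r - y)) =
  (\prod_(y <- ys) (r - y)) * (\prod_(y <- ys) (w * r - y)) *
  (\prod_(y <- ys) (w ^+ 2 * r - y)) by rewrite -!big_split.
have nz c : all (fun y => c != y) ys -> \prod_(y <- ys) (c - y) != 0.
  move=> /allP cys; rewrite prodf_seq_neq0; apply/allP => y yys /=.
  by rewrite subr_eq0 cys.
have P1 : \prod_(y <- ys) (r - y) != 0.
  by apply: nz; apply: sub_all rys => y /andP[].
have P2 : \prod_(y <- ys) (w * r - y) != 0.
  by apply: nz; apply: sub_all rys => y /andP[].
have P3 : w * r - r != 0.
  by rewrite -[X in _ - X]mul1r -mulrBl mulf_neq0 // subr_eq0.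
have -> : - (w ^+ 2 * r) = (w + 1) * r.
  by apply/eqP; rewrite -subr_eq0 -[X in _ == X]oppr0 -(mul0r r) -w3; apply/eqP; ring.
rewrite !invfM; set V := (vdm _ _)^-1; set A := \prod_(y <- ys) (_ - y) in P1 *.
by field; rewrite P1 P2 P3.
Qed.

Definition with_inverses xs := flatten [seq [:: x; x^-1] | x <- xs].

Lemma size_with_inverses xs : size (with_inverses xs) = (2 * size xs)%N.
Proof. by elim: xs => //= x xs ->; lia. Qed.

Lemma with_inverses_inv xs y :
  y \in with_inverses xs -> y^-1 \in with_inverses xs.
Proof.
elim: xs => //= x xs IH; rewrite !inE => /or3P[/eqP->|/eqP->|/IH->].
- by rewrite eqxx !orbT.
- by rewrite invrK eqxx.
- by rewrite !orbT.
Qed.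

Lemma dvdp_prod_XsubC_exp (ys : seq K) k (N : {poly K}) : uniq ys ->
  (forall y, y \in ys -> ('X - y%:P) ^+ k %| N) ->
  \prod_(y <- ys) ('X - y%:P) ^+ k %| N.
Proof.
elim: ys => [|y ys IH]; first by rewrite big_nil dvd1p.
rewrite /= => /andP[yys uys] dN; rewrite big_cons Gauss_dvdp.
  rewrite dN ?mem_head // IH // => z zys; apply: dN.
  by rewrite inE zys orbT.
apply: coprimep_expl; rewrite coprimep_sym coprimep_XsubC rootE horner_prod.
rewrite prodf_seq_neq0; apply/allP => z zys /=.
rewrite horner_exp expf_eq0 negb_and !hornerE subr_eq0.
by apply/orP; right; apply: contraNneq yys => ->.
Qed.

Section Numerator.
Variables (n : nat) (ys : seq K).
Local Notation d := (3 * n + 2)%N.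
Local Notation e := (stair_exp n.+1).

(** The matrix of the alternant at X, 1/X and [ys]; the row of 1/X is multiplied by X ^ d, where d
    is the largest exponent, to make it polynomial. *)
Definition num_entry i j : {poly K} :=
  match i with
  | 0 => 'X^(e j) | 1 => 'X^(d - e j) | i'.+2 => (ys`_i' ^+ e j)%:P
  end.

Definition num_poly := det_fun (2 * n).+2 num_entry.

Lemma num_poly_horner x : x != 0 ->
  num_poly.[x] = x ^+ d * alternant n.+1 [:: x, x^-1 & ys].
Proof.
move=> x0; rewrite /num_poly det_fun_horner /alternant.
have -> : (2 * n.+1 = (2 * n).+2)%N by lia.
pose c i := if i == 1%N then x ^+ d else 1.
have -> : x ^+ d = \prod_(i < (2 * n).+2) c i.
  by rewrite !big_ord_recl big1 /c //= mul1r mulr1.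
rewrite -det_fun_scale; apply: eq_det_fun => i j im jm; rewrite /c.
case: i im => [|[|i]] im /=; rewrite ?mul1r ?hornerXn ?hornerC //.
by rewrite exprVn -exprB ?unitfE ?stair_exp_leq.
Qed.

Lemma size_num_poly : (size num_poly <= 6 * n + 5)%N.
Proof.
rewrite /num_poly /det_fun /determinant.
apply: (leq_trans (size_sum _ _ _)); apply/bigmax_leqP => s _.
rewrite -signr_odd mulr_sign.
have -> (b : bool) (P : {poly K}) : size (if b then - P else P) = size P.
  by case: b; rewrite ?size_polyN.
apply: (leq_trans (size_prod_leq _ _)).
rewrite card_ord.
have sM (i : 'I_(2 * n).+2) :
  (size ((\matrix_(i < (2 * n).+2, j < (2 * n).+2) num_entry i j) i (s i)) <=
   if (i < 2)%N then (3 * n + 3)%N else 1%N)%N.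
  rewrite mxE /num_entry; have := stair_exp_leq n (s i).
  case: i => [[|[|i]] im] /= le; rewrite ?size_polyXn ?size_polyC; try lia.
have := @leq_sum _ (index_enum 'I_(2 * n).+2) xpredT _ _ (fun i _ => sM i).
rewrite [X in (_ <= X)%N]big_ord_recl [X in (_ <= _ + X)%N]big_ord_recl /=.
rewrite sum_nat_const card_ord; set T := (\sum_(i < _) _)%N; move: T => T; lia.
Qed.

(** As c is its own inverse, the second row at X = c is c ^ d times the first. *)
Lemma num_poly_root c : c ^+ 2 = 1 -> root num_poly c.
Proof.
move=> c2; have c0 : c != 0.
  by apply: contraTneq (oner_neq0 K) => c0; rewrite -c2 c0 expr0n /= eqxx.
rewrite /root /num_poly det_fun_horner.
rewrite -(@det_fun_row_sub _ _ 1 0 _ (c ^+ d)) //.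
set f := fun i j => _.
rewrite (@eq_det_fun _ _ _ (set_row f 1 (fun j => 0 * 0 + 0 * 0))).
  by rewrite det_fun_row_lin // !mul0r addr0.
move=> i j im jm; rewrite /set_row; case: eqP => // _.
rewrite /f /= !hornerXn !mul0r addr0; apply/eqP; rewrite subr_eq0; apply/eqP.
apply: (mulfI (expf_neq0 (e j) c0)).
by rewrite -exprD subnKC ?stair_exp_leq // mulrCA -exprMn -expr2 c2 expr1n mulr1.
Qed.

Hypothesis sys : size ys = (2 * n)%N.
Hypothesis ys0 : forall y, y \in ys -> y != 0.
Hypothesis ysV : forall y, y \in ys -> y^-1 \in ys.

(** At X = y the first row equals the row of y, and the second is y ^ d times the row of 1/y.
    Subtracting these constant rows leaves a factor X - y in each of the first two rows. *)
Lemma num_poly_dvd_sq y : y \in ys -> ('X - y%:P) ^+ 2 %| num_poly.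
Proof.
move=> yys; have y0 := ys0 yys.
have /(nthP 0)[k km yk] := yys.
have /(nthP 0)[l lm yl] := ysV yys.
rewrite sys in km lm.
rewrite /num_poly -(@det_fun_row_sub _ _ 0 k.+2 _ 1) //.
rewrite -(@det_fun_row_sub _ _ 1 l.+2 _ (y ^+ d)%:P) //.
(* [g m] is the quotient of X ^ m - y ^ m by X - y; the summand [0 * 0] brings a row into the form
   of [det_fun_row_lin]. *)
pose g m : {poly K} := \sum_(i < m) 'X^(m.-1 - i) * y%:P ^+ i.
have gE m : 'X^m - (y ^+ m)%:P = ('X - y%:P) * g m + 0 * 0.
  by rewrite mul0r addr0 rmorphXn /= subrXX.
set f := set_row _ _ _.
rewrite (@eq_det_fun _ _ _ (set_row f 1
  (fun j => ('X - y%:P) * g (d - e j)%N + 0 * 0))); last first.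
  move=> i j im jm; rewrite /set_row; case: eqP => // ->.
  rewrite /f /set_row /= -gE yl; congr (_ - _).
  by rewrite -polyCM exprVn -exprB ?unitfE ?stair_exp_leq.
rewrite det_fun_row_lin // mul0r addr0.
rewrite (@eq_det_fun _ _ _ (set_row (set_row num_entry 1 (fun j => g (d - e j)%N)) 0
   (fun j => ('X - y%:P) * g (e j) + 0 * 0))); last first.
  move=> [|[|i]] j im jm; rewrite /f /set_row //=.
  by rewrite -gE yk mul1r.
by rewrite det_fun_row_lin // mul0r addr0 mulrA -expr2 dvdp_mulr.
Qed.

End Numerator.

(** For each pair, (1/x - y) (1/x - 1/y) = x ^ -2 (x - y) (x - 1/y). *)
Lemma prod_sub_with_inverses (x : K) xs : x != 0 -> all (fun y => y != 0) xs ->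
  \prod_(y <- with_inverses xs) (x^-1 - y) =
  x ^- (2 * size xs) * \prod_(y <- with_inverses xs) (x - y).
Proof.
move=> x0; elim: xs => [|y xs IH]; first by rewrite !big_nil invr1 mulr1.
case/andP=> y0 /IH IHxs; rewrite !big_cons {}IHxs [size _]/= mulnS exprD.
set A := \prod_(j <- _) _; set N := x ^+ (2 * _).
have N0 : N != 0 by rewrite expf_neq0.
by field; rewrite x0 y0 N0.
Qed.

(* X ^ n * s (X, 1/X, ys) is a polynomial because the numerator of the
   bialternant formula has a double root at each y in ys, and the roots 1, -1. *)
Lemma staircase_schur_poly n xs : size xs = n ->
  let ys := with_inverses xs in
  all (fun x => x != 0) xs -> uniq [:: 1, -1 & ys] ->
  exists2 Q : {poly K}, (size Q <= 2 * n + 3)%N &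
    forall x, x != 0 -> x ^+ 2 != 1 -> x \notin ys ->
      x ^+ n.+1 * staircase_schur n.+1 [:: x, x^-1 & ys] = Q.[x].
Proof.
move=> sxs ys xs0 uys.
have sys : size ys = (2 * n)%N by rewrite size_with_inverses sxs.
have ysV := @with_inverses_inv xs.
have ys0 y : y \in ys -> y != 0.
  rewrite /ys; elim: (xs) xs0 => //= x l IH /andP[x0 l0].
  by rewrite !inE => /or3P[/eqP->|/eqP->|/(IH l0)]; rewrite ?invr_eq0.
have [uy m1] : uniq ys /\ (1 : K) != -1.
  by move: uys; rewrite /= !inE negb_or => /and3P[/andP[-> _] _ ->].
have [n1 nm1] : 1 \notin ys /\ -1 \notin ys.
  by move: uys; rewrite /= !inE negb_or => /and3P[/andP[_ ->] -> _].
pose D : {poly K} := \prod_(c <- [:: 1, -1 & ys ++ ys]) ('X - c%:P).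
have DE : D = ('X - 1%:P) * (('X - (-1)%:P) * \prod_(y <- ys) ('X - y%:P) ^+ 2).
  by rewrite /D !big_cons big_cat /= -big_split.
have prodN (c : K) : c \notin ys -> ~~ root (\prod_(y <- ys) ('X - y%:P) ^+ 2) c.
  move=> cys; rewrite rootE horner_prod prodf_seq_neq0; apply/allP => z zys /=.
  rewrite horner_exp expf_eq0 negb_and !hornerE subr_eq0.
  by apply: contraNneq cys => ->.
have : D %| num_poly n ys.
  have ds y := @num_poly_dvd_sq _ _ sys ys0 ysV y.
  rewrite DE Gauss_dvdp; last first.
    by rewrite coprimep_sym coprimep_XsubC rootM negb_or root_XsubC m1 prodN.
  rewrite Gauss_dvdp; last by rewrite coprimep_sym coprimep_XsubC prodN.
  rewrite !dvdp_XsubCl !num_poly_root ?expr1n ?sqrrN ?expr1n //=.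
  exact: dvdp_prod_XsubC_exp.
case/dvdpP=> Q0 numE; exists ((vdm (2 * n) ys)^-1 *: Q0).
  apply: (leq_trans (size_scale_leq _ _)).
  have [->|Q00] := eqVneq Q0 0; first by rewrite size_poly0.
  (* The numerator has degree at most 6 n + 4 and D has degree 4 n + 2, which leaves 2 n + 2. *)
  have := size_num_poly n ys; rewrite numE size_Mmonic ?monic_prod_XsubC //.
  rewrite /D size_prod_XsubC /= size_cat sys; set t := size _; move: t => t; lia.
move=> x x0 x1 xys; rewrite hornerZ /staircase_schur.
have -> : (2 * n.+1 = (2 * n).+2)%N by lia.
rewrite vdm_cons /= ?sys // vdm_cons // big_cons prod_sub_with_inverses // -/ys sxs.
have := num_poly_horner n ys x0; rewrite numE hornerM DE !hornerM horner_prod.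
under eq_bigr => y _ do rewrite horner_exp !hornerXsubC.
rewrite prodrXl !hornerXsubC.
set A := \prod_(y <- ys) (x - y).
have A0 : A != 0.
  rewrite prodf_seq_neq0; apply/allP => z zys /=.
  by rewrite subr_eq0; apply: contraNneq xys => ->.
have xx0 : x ^+ 2 - 1 != 0 by rewrite subr_eq0.
rewrite !invfM; set V := (vdm _ _)^-1; set a := alternant _ _.
have -> : x ^+ (3 * n + 2) = x ^+ n * x ^+ n * x ^+ n * x ^+ 2.
  by rewrite -!exprD; congr (_ ^+ _); clear; lia.
have -> : x ^+ (2 * n) = x ^+ n * x ^+ n by rewrite -exprD; congr (_ ^+ _); clear; lia.
rewrite (exprS x n); have : x ^+ n != 0 by rewrite expf_neq0.
set X := x ^+ n => X0 aE.
have -> : a = Q0.[x] * ((x - 1) * ((x - -1) * A ^+ 2)) / (X * X * X * x ^+ 2).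
  by rewrite aE; field; rewrite X0 x0.
by field; rewrite X0 x0 A0 oner_neq0 -expr2 xx0.
Qed.

End Schur.

Section Products.
Variable R : comNzRingType.

Lemma prod_scale_seq (I : Type) (s : seq I) c (f : I -> R) :
  \prod_(i <- s) (c * f i) = c ^+ size s * \prod_(i <- s) f i.
Proof.
elim: s => [|i s IH]; first by rewrite !big_nil mulr1.
by rewrite !big_cons IH exprS; ring.
Qed.

Lemma prod_mirror (s : seq R) c (f : R -> R) :
  \prod_(z <- s ++ c :: rev s) f z = f c * \prod_(z <- s) f z ^+ 2.
Proof. by rewrite big_cat big_cons big_rev /= prodrXl; ring. Qed.

End Products.

Lemma prod_with_inverses (K : fieldType) (xs : seq K) (f : K -> K) :
  \prod_(y <- with_inverses xs) f y = \prod_(x <- xs) (f x * f x^-1).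
Proof.
elim: xs => [|x xs IH]; first by rewrite !big_nil.
by rewrite /= !big_cons IH mulrA.
Qed.

(** * Reductions of the Schur function at cube roots of unity *)

Section CubeRoot.
Variable K : fieldType.
Implicit Types (x y w : K) (ys : seq K).

(** Here x and 1/x themselves have ratio w, and the third member of their triple is w ^ 2 / x = x ^
    3. *)
Lemma staircase_schur_wheel1 n x w ys :
  w ^+ 2 + w + 1 = 0 -> w != 1 -> x ^+ 2 = w -> x != 0 ->
  size ys = (2 * n)%N -> uniq [:: x, x^-1 & ys] ->
  staircase_schur n.+1 [:: x, x^-1 & ys] =
  - x ^+ 3 * (\prod_(y <- ys) (x ^+ 3 - y)) * staircase_schur n ys.
Proof.
move=> w3 w1 xw x0 sys /=; rewrite inE negb_or => /and3P[/andP[_ xys] x'ys _].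
have E : x = w * x^-1 by rewrite -xw expr2 mulfK.
have E3 : w ^+ 2 * x^-1 = x ^+ 3 by rewrite -xw; field.
rewrite {1}E staircase_schur_wheel ?invr_eq0 // ?E3 // -E.
apply/allP => y yys; apply/andP; split.
  by apply: contraNneq x'ys => ->.
by apply: contraNneq xys => ->.
Qed.

(** Both (x, 1/x1) and (x1, 1/x) have the form (w r, r). After reordering, two reductions apply, and
    the third members of the triples are 1 / (w x1) and w x1. *)
Lemma staircase_schur_wheel2 n x x1 w ys :
  w ^+ 2 + w + 1 = 0 -> w != 1 -> x * x1 = w -> x != 0 -> x1 != 0 ->
  size ys = (2 * n)%N -> uniq [:: x, x^-1, x1, x1^-1 & ys] ->
  staircase_schur n.+2 [:: x, x^-1, x1, x1^-1 & ys] =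
  ((w * x1)^-1 - x1) * ((w * x1)^-1 - x^-1) *
  (\prod_(y <- ys) ((w * x1 - y) * ((w * x1)^-1 - y))) * staircase_schur n ys.
Proof.
move=> w3 w1 xw x0 x10 sys uys.
have w0 : w != 0 by rewrite -xw mulf_neq0.
have pe : perm_eq [:: x, x^-1, x1, x1^-1 & ys] [:: x, x1^-1, x1, x^-1 & ys].
  by apply/seq.permP => a /=; lia.
rewrite (staircase_schur_perm _ pe); last by rewrite /= sys; clear; lia.
move: uys; rewrite (perm_uniq pe) /= !inE !negb_or.
case/and5P=> /and4P[_ xx1 xx' xys] /and3P[x1'x1 x1'x' x1'ys] /andP[x1x' x1ys] x'ys uys.
have E : x = w * x1^-1 by rewrite -xw mulfK.
have E1 : x1 = w * x^-1 by rewrite -xw mulrC mulKf.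
have w31 := cube_root1 w3.
have T1 : w ^+ 2 * x1^-1 = (w * x1)^-1.
  by apply: (mulfI w0); rewrite invfM mulVKf // mulrA -exprS w31 mul1r.
have T2 : w ^+ 2 * x^-1 = w * x1 by rewrite [in RHS]E1 mulrA.
rewrite {1}E staircase_schur_wheel ?invr_eq0 //; first last.
- rewrite -E /= x1'x1 xx1 x1'x' xx' /=; apply/allP => y yys; apply/andP; split.
    by apply: contraNneq x1'ys => ->.
  by apply: contraNneq xys => ->.
- by rewrite /= sys; clear; lia.
rewrite [X in staircase_schur _ (X :: _)]E1.
rewrite staircase_schur_wheel ?invr_eq0 //; last first.
  rewrite -E1; apply/allP => y yys; apply/andP; split.
    by apply: contraNneq x'ys => ->.
  by apply: contraNneq x1ys => ->.
rewrite T1 T2 !big_cons big_split /=.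
set P1 := \prod_(y <- _) _; set P2 := \prod_(y <- _) _.
by field; rewrite w0 x10 x0.
Qed.

End CubeRoot.

(** * Recursions at a twelfth root of unity *)

Section RootOfUnity.
Variables (K : fieldType) (q p : K).
(** The twelfth cyclotomic polynomial vanishes at [q]; the identities in [q] below are reduced by
    this relation. *)
Hypothesis q4E : q ^+ 4 = q ^+ 2 - 1.
Hypothesis three_neq0 : (3%:R : K) != 0.

Implicit Types (u z t : K) (us : seq K).

Lemma q_neq0 : q != 0.
Proof.
apply: contra_eqN q4E => /eqP->; rewrite !expr0n /= sub0r eq_sym oppr_eq0.
exact: oner_neq0.
Qed.

Lemma q6E : q ^+ 6 = -1.
Proof. by rewrite (exprD _ 4 2) q4E mulrBl mul1r -exprD q4E; ring. Qed.

Lemma qV2E : q ^- 2 = - q ^+ 4.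
Proof.
apply: (mulfI (expf_neq0 2 q_neq0)); rewrite divff ?expf_neq0 ?q_neq0 //.
by rewrite mulrN -exprD q6E opprK.
Qed.

Lemma qV4E : q ^- 4 = - q ^+ 2.
Proof.
apply: (mulfI (expf_neq0 4 q_neq0)); rewrite divff ?expf_neq0 ?q_neq0 //.
by rewrite mulrN -exprD q6E opprK.
Qed.

Lemma q4_root : (q ^+ 4) ^+ 2 + q ^+ 4 + 1 = 0.
Proof.
have -> : (q ^+ 4) ^+ 2 = q ^+ 6 * q ^+ 2 by ring.
by rewrite q6E q4E; ring.
Qed.

Lemma q4_neq1 : q ^+ 4 != 1.
Proof.
apply: contra_eq_neq q4_root => ->; rewrite expr1n.
by have -> : 1 + 1 + 1 = 3%:R :> K by ring.
Qed.

Lemma qV4_root : (q ^- 4) ^+ 2 + q ^- 4 + 1 = 0.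
Proof.
have q0 := q_neq0; have -> : (q ^- 4) ^+ 2 + q ^- 4 + 1 =
  ((q ^+ 4) ^+ 2 + q ^+ 4 + 1) * q ^- 8 by field.
by rewrite q4_root mul0r.
Qed.

Lemma qV4_neq1 : q ^- 4 != 1.
Proof. by rewrite invr_eq1 q4_neq1. Qed.

(** Bulk and corner weights thus have the same denominator. Its square is -3, the source of the
    powers of 3 in the formula. *)
Lemma sigma_q4 : sigma (q ^+ 4) = sigma (q ^+ 2).
Proof. by rewrite /sigma qV2E qV4E; ring. Qed.

Lemma sigma_q2_sq : sigma (q ^+ 2) * sigma (q ^+ 2) = - 3%:R.
Proof.
rewrite /sigma qV2E; have -> : (q ^+ 2 - - q ^+ 4) * (q ^+ 2 - - q ^+ 4) =
  q ^+ 4 + 2%:R * q ^+ 6 + q ^+ 6 * q ^+ 2 by ring.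
by rewrite q6E q4E; ring.
Qed.

Lemma sigma_q2_neq0 : sigma (q ^+ 2) != 0.
Proof.
have : sigma (q ^+ 2) * sigma (q ^+ 2) != 0 by rewrite sigma_q2_sq oppr_eq0.
by rewrite mulf_eq0 negb_or => /andP[].
Qed.

Lemma sigma_q4_neq0 : sigma (q ^+ 4) != 0.
Proof. by rewrite sigma_q4 sigma_q2_neq0. Qed.

Lemma sigmaV_mul t : t != 0 ->
  sigma (q ^+ 2 * t) * sigma (q ^+ 2 * t^-1) = - (t ^+ 2 + 1 + t ^- 2).
Proof.
move=> t0; have q0 := q_neq0.
have -> : sigma (q ^+ 2 * t) * sigma (q ^+ 2 * t^-1) =
   q ^+ 4 + q ^- 4 - t ^+ 2 - t ^- 2 by rewrite /sigma; field; rewrite t0 q0.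
by rewrite qV4E q4E; ring.
Qed.

Lemma inv_sign (e : K) : e ^+ 2 = 1 -> e^-1 = e.
Proof.
move=> e2; have e0 : e != 0.
  by apply: contra_eq_neq e2 => ->; rewrite expr0n /= eq_sym oner_neq0.
by apply: (mulfI e0); rewrite divff // -expr2.
Qed.

Lemma sigma_sign e t : e ^+ 2 = 1 -> sigma (e * t) = e * sigma t.
Proof.
by move=> e2; rewrite /sigma invfM inv_sign //; ring.
Qed.

Lemma sigma_mul (a b : K) : a != 0 -> b != 0 ->
  sigma a * sigma b = a * b + (a * b)^-1 - a / b - b / a.
Proof. by move=> a0 b0; rewrite /sigma; field; rewrite a0 b0. Qed.

Definition boundary_factor u := p ^+ 2 * u ^+ 2 + 1 + p ^- 2 * u ^- 2.

Definition product_formula us : K :=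
  3%:R ^- 'C((size us).+1, 2) * (\prod_(u <- us) boundary_factor u) *
  staircase_schur (size us) (with_inverses [seq u ^+ 2 | u <- us]).

Hypothesis p_neq0 : p != 0.
Local Notation Zup := (Zup q p p).
Local Notation squares us := (with_inverses [seq u ^+ 2 | u <- us]).

Lemma size_squares us : size (squares us) = (2 * size us)%N.
Proof. by rewrite size_with_inverses size_map. Qed.

(** The factor of [u] in the product formula comes from the two kinds of weights of the central
    column, whose labels are [u * p]. *)
Lemma boundary_factor_sigma u : u != 0 ->
  sigma (q ^+ 2 * (u * p)) * sigma (q ^+ 2 * (u * p)^-1) = - boundary_factor u.
Proof.
move=> u0; rewrite sigmaV_mul ?mulf_neq0 // /boundary_factor.
by congr (- (_ + 1 + _)); field; rewrite ?u0 ?p_neq0.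
Qed.

Lemma sigma_div_mul (a b c : K) : a * b = - c ->
  a / sigma (q ^+ 2) * (b / sigma (q ^+ 2)) = c / 3%:R.
Proof.
move=> abc; rewrite mulf_div sigma_q2_sq abc; field; rewrite oppr_eq0 three_neq0 //.
Qed.

(** The sign [e] tells apart the two square roots z ^ 2 of [w], whose cubes are 1 and -1. The
    binomial exponent of 3 grows by [size us + 1]: one factor per element of [us] and one for
    [boundary_factor z]. *)
Lemma product_formula_cons z us e w : z != 0 -> all (fun u => u != 0) us ->
  e ^+ 2 = 1 -> (z ^+ 2) ^+ 3 = - e ->
  w ^+ 2 + w + 1 = 0 -> w != 1 -> (z ^+ 2) ^+ 2 = w ->
  uniq (squares (z :: us)) ->
  product_formula (z :: us) = e / 3%:R * boundary_factor z *
    (\prod_(u <- us) ((2%:R + e * (u ^+ 2 + u ^- 2)) / 3%:R)) *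
    product_formula us.
Proof.
move=> z0 us0 e2 z6 w3 w1 zw uz; rewrite /product_formula [squares _]/=.
rewrite (@staircase_schur_wheel1 _ _ _ w) ?expf_neq0 ?size_squares // z6.
rewrite prod_with_inverses big_map.
have -> : \prod_(u <- us) ((- e - u ^+ 2) * (- e - (u ^+ 2)^-1)) =
   3%:R ^+ size us * \prod_(u <- us) ((2%:R + e * (u ^+ 2 + u ^- 2)) / 3%:R).
  rewrite -prod_scale_seq; apply: eq_big_seq => u uus.
  have u0 : u != 0 by apply: (allP us0).
  transitivity (e ^+ 2 + 1 + e * (u ^+ 2 + u ^- 2)); first by field; rewrite ?u0.
  by rewrite e2; field; rewrite ?u0 three_neq0.
rewrite binS bin1 exprD invfM exprS big_cons opprK [size (z :: us)]/=.
set A := \prod_(u <- us) _; set B := \prod_(u <- us) _.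
set C := 3%:R ^+ 'C(_, _); set D := 3%:R ^+ _.
have D0 : D != 0 by rewrite expf_neq0 ?three_neq0.
have C0 : C != 0 by rewrite expf_neq0 ?three_neq0.
by field; rewrite D0 C0 three_neq0.
Qed.

(** The columns occur in mirror pairs, so each [u] contributes a squared weight, which is its factor
    in the Schur recursion. One corner together with the central vertex gives
    [boundary_factor z / 3], the opposite corner gives [e]. *)
Lemma Zup_cons_special z us e : z != 0 -> all (fun u => u != 0) us ->
  e ^+ 2 = 1 -> z ^+ 2 * q ^+ 2 = e \/ z ^+ 2 = e * q ^+ 2 ->
  uniq (squares (z :: us)) ->
  Zup us = product_formula us -> Zup (z :: us) = product_formula (z :: us).
Proof.
move=> z0 us0 e2 ze uz IH; have q0 := q_neq0.
have e0 : e != 0.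
  by apply: contra_eq_neq e2 => ->; rewrite expr0n /= eq_sym oner_neq0.
have eV := inv_sign e2.
have zz0 : z ^+ 2 != 0 by rewrite expf_neq0.
have sige : sigma e = 0 by rewrite /sigma eV subrr.
have sq4e : sigma (e * q ^+ 4) / sigma (q ^+ 2) = e.
  by rewrite sigma_sign // sigma_q4 mulfK ?sigma_q2_neq0.
case: ze => ze.
  have z2 : z ^+ 2 = e * q ^- 2 by rewrite -ze mulfK // expf_neq0.
  rewrite (@product_formula_cons _ _ e (q ^- 4)) ?qV4_root ?qV4_neq1 //; first last.
  - by rewrite z2 exprMn e2 mul1r -exprVn -exprM exprVn.
  - by rewrite z2 exprMn (exprS e 2) e2 -exprVn -exprM exprVn q6E invrN1; ring.
  rewrite Zup_cons_left ?q_neq0 // -?IH; last by rewrite mulrC ze.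
  rewrite prod_mirror.
  have -> : \prod_(u <- us) (sigma (q ^+ 2 / (z * u)) / sigma (q ^+ 4)) ^+ 2 =
     \prod_(u <- us) ((2%:R + e * (u ^+ 2 + u ^- 2)) / 3%:R).
    apply: eq_big_seq => u uus.
    have u0 : u != 0 by apply: (allP us0).
    rewrite sigma_q4 expr2; apply: sigma_div_mul.
    rewrite sigma_mul ?mulf_neq0 ?invr_eq0 ?mulf_neq0 //.
    rewrite divff ?mulf_neq0 ?invr_eq0 ?mulf_neq0 //.
    transitivity (q ^+ 4 / (z ^+ 2 * u ^+ 2) + z ^+ 2 * u ^+ 2 / q ^+ 4 - 2%:R).
      by field; rewrite q0 z0 u0.
    have -> : q ^+ 4 / (z ^+ 2 * u ^+ 2) = - e * u ^- 2.
      rewrite invfM z2 invfM invrK eV; transitivity (e * q ^+ 6 / u ^+ 2); first by field.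
      by rewrite q6E; ring.
    have -> : z ^+ 2 * u ^+ 2 / q ^+ 4 = - e * u ^+ 2.
      rewrite z2; transitivity (e / q ^+ 6 * u ^+ 2); first by field.
      by rewrite q6E invrN1; ring.
    ring.
  set A := \prod_(u <- us) _.
  have key : left_weight q p z true false *
      (sigma (q ^+ 2 / (z * p)) / sigma (q ^+ 4)) = boundary_factor z / 3%:R.
    rewrite sigma_q4; apply: sigma_div_mul; rewrite -boundary_factor_sigma //.
    by congr (sigma _ * _); ring.
  have -> : right_weight q p z true true = e.
    rewrite /= -[RHS]sq4e; congr (sigma _ / _).
    by rewrite exprVn z2 invfM invrK eV; ring.
  by rewrite [_ * (_ * A)]mulrA key; ring.
rewrite (@product_formula_cons _ _ e (q ^+ 4)) ?q4_root ?q4_neq1 //; first last.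
- by rewrite ze exprMn e2 mul1r -exprM.
- by rewrite ze exprMn (exprS e 2) e2 -exprM q6E; ring.
have qz : q ^+ 2 * z^-1 ^+ 2 = e by rewrite exprVn ze invfM eV; field.
rewrite Zup_cons_right ?q_neq0 // -?IH; last by rewrite qz.
rewrite prod_mirror.
have -> : \prod_(u <- us) (sigma (q ^+ 2 * (z * u)) / sigma (q ^+ 4)) ^+ 2 =
   \prod_(u <- us) ((2%:R + e * (u ^+ 2 + u ^- 2)) / 3%:R).
  apply: eq_big_seq => u uus.
  have u0 : u != 0 by apply: (allP us0).
  rewrite sigma_q4 expr2; apply: sigma_div_mul.
  rewrite sigma_mul ?mulf_neq0 // divff ?mulf_neq0 //.
  transitivity (q ^+ 4 * z ^+ 2 * u ^+ 2 + (q ^+ 4 * z ^+ 2)^-1 / u ^+ 2 - 2%:R).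
    by field; rewrite q0 z0 u0.
  have -> : q ^+ 4 * z ^+ 2 = - e.
    by rewrite ze; transitivity (e * q ^+ 6); [ring | rewrite q6E; ring].
  by rewrite invrN eV; ring.
set A := \prod_(u <- us) _.
have key : sigma (q ^+ 2 * (z * p)) / sigma (q ^+ 4) *
   right_weight q p z true false = boundary_factor z / 3%:R.
  rewrite sigma_q4; apply: sigma_div_mul; rewrite -boundary_factor_sigma //.
  by congr (_ * sigma _); rewrite invfM; ring.
have -> : left_weight q p z true true = e.
  by rewrite /= -[RHS]sq4e; congr (sigma _ / _); rewrite ze; ring.
rewrite [_ / _ * A]mulrC.
transitivity (e * A * (boundary_factor z / 3%:R) * Zup us); last by ring.
by rewrite -key; ring.
Qed.

(** [T] and its inverse are the third members of the two triples that lose their other members. The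
    exponent of 3 grows by [2 * size us + 3]. *)
Lemma product_formula_cons2 z u us w : z != 0 -> u != 0 ->
  all (fun t => t != 0) us -> uniq (squares (z :: u :: us)) ->
  z ^+ 2 * u ^+ 2 = w -> w ^+ 2 + w + 1 = 0 -> w != 1 ->
  let T := w * u ^+ 2 in
  product_formula (z :: u :: us) =
    (T^-1 - u ^+ 2) * (T^-1 - z ^- 2) / 3%:R ^+ 3 *
    (boundary_factor z * boundary_factor u) *
    (\prod_(t <- us) (((T + T^-1 - t ^+ 2 - t ^- 2) / 3%:R) ^+ 2)) *
    product_formula us.
Proof.
move=> z0 u0 us0 uz zuw w3 w1 T; rewrite /product_formula [squares _]/=.
have w0 : w != 0 by rewrite -zuw mulf_neq0 ?expf_neq0.
have T0 : T != 0 by rewrite mulf_neq0 ?expf_neq0.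
rewrite (@staircase_schur_wheel2 _ _ _ _ w) ?expf_neq0 ?size_squares // -/T.
rewrite prod_with_inverses big_map.
have -> : \prod_(t <- us) ((T - t ^+ 2) * (T^-1 - t ^+ 2) *
     ((T - (t ^+ 2)^-1) * (T^-1 - (t ^+ 2)^-1))) =
   (3%:R ^+ 2) ^+ size us *
   \prod_(t <- us) (((T + T^-1 - t ^+ 2 - t ^- 2) / 3%:R) ^+ 2).
  rewrite -prod_scale_seq; apply: eq_big_seq => t tus.
  have t0 : t != 0 by apply: (allP us0).
  by field; rewrite ?T0 ?t0 three_neq0.
have CE : 'C((size (z :: u :: us)).+1, 2) =
    ('C((size us).+1, 2) + (2 * size us + 3))%N.
  by rewrite [size _]/= binS bin1 binS bin1; clear; lia.
rewrite CE (exprD _ _ (_ + _)) (exprD _ _ 3) (exprM _ 2) !big_cons.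
set A := \prod_(t <- us) _; set B := \prod_(t <- us) _.
set C := 3%:R ^+ 'C(_, _); set D := 3%:R ^+ 2 ^+ _.
have D0 : D != 0 by rewrite !expf_neq0 ?three_neq0.
have C0 : C != 0 by rewrite expf_neq0 ?three_neq0.
set E := 3%:R ^+ 3; have E0 : E != 0 by rewrite expf_neq0 ?three_neq0.
by field; rewrite C0 D0 E0 z0 T0.
Qed.

(** Each of the two central vertices is paired with a corner weight to give the boundary factor of
    its row ([K1], [K2]); the other two corners give the two factors of the Schur recursion in which
    [z] and [u] meet [T] ([K3]). *)
Lemma Zup_cons2_special z u us : z != 0 -> u != 0 ->
  all (fun t => t != 0) us -> uniq (squares (z :: u :: us)) ->
  z * u = q ^+ 2 \/ z * u * q ^+ 2 = 1 ->
  Zup us = product_formula us ->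
  Zup (z :: u :: us) = product_formula (z :: u :: us).
Proof.
move=> z0 u0 us0 uzu zu IH; have q0 := q_neq0.
have s9 (a b c : K) : a * b = c ->
   (a / sigma (q ^+ 2)) ^+ 2 * (b / sigma (q ^+ 2)) ^+ 2 = (c / 3%:R) ^+ 2.
  by move=> abc; rewrite -exprMn (@sigma_div_mul _ _ (- c)) ?opprK // mulNr sqrrN.
case: zu => zu.
  have zE : z = q ^+ 2 / u by rewrite -zu mulfK.
  rewrite (@product_formula_cons2 _ _ _ (q ^+ 4)) ?q4_root ?q4_neq1 //; last first.
    by rewrite -exprMn zu -exprM.
  rewrite Zup_cons2_right ?sigma_q4_neq0 ?sigma_q2_neq0 // IH !prod_mirror.
  set T := q ^+ 4 * u ^+ 2.
  have -> : \prod_(t <- us) ((T + T^-1 - t ^+ 2 - t ^- 2) / 3%:R) ^+ 2 =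
    \prod_(t <- us) (sigma (q ^+ 2 * (z * t)) / sigma (q ^+ 4)) ^+ 2 *
    \prod_(t <- us) (sigma (q ^+ 2 * (u * t)) / sigma (q ^+ 4)) ^+ 2.
    rewrite -big_split; apply: eq_big_seq => t tus /=.
    have t0 : t != 0 by apply: (allP us0).
    rewrite sigma_q4; symmetry; apply: s9; rewrite sigma_mul ?mulf_neq0 //.
    have -> : q ^+ 2 * (z * t) * (q ^+ 2 * (u * t)) = - t ^+ 2.
      transitivity (q ^+ 4 * (z * u) * t ^+ 2); first by ring.
      by rewrite zu -exprD q6E; ring.
    have -> : q ^+ 2 * (z * t) / (q ^+ 2 * (u * t)) = - T^-1.
      rewrite zE /T; transitivity (- (- q ^+ 6) / (q ^+ 4 * u ^+ 2)).
        by field; rewrite q0 u0 t0.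
      by rewrite q6E; ring.
    have -> : q ^+ 2 * (u * t) / (q ^+ 2 * (z * t)) = - T.
      rewrite zE /T; transitivity (q ^+ 4 * u ^+ 2 / q ^+ 6).
        by field; rewrite q0 u0 t0.
      by rewrite q6E invrN1; ring.
    by rewrite invrN; ring.
  set A := \prod_(t <- us) _; set B := \prod_(t <- us) _.
  have K1 : sigma (q ^+ 2 * (z * p)) / sigma (q ^+ 4) *
      (sigma (p^-1 * u) / sigma (q ^+ 2)) = boundary_factor z / 3%:R.
    rewrite sigma_q4; apply: sigma_div_mul; rewrite -boundary_factor_sigma //.
    by congr (_ * sigma _); rewrite zE; field; rewrite p_neq0 q0 u0.
  have K2 : sigma (q ^+ 2 * (u * p)) / sigma (q ^+ 4) *
      right_weight q p u true false = boundary_factor u / 3%:R.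
    rewrite sigma_q4; apply: sigma_div_mul; rewrite -boundary_factor_sigma //.
    by congr (_ * sigma _); rewrite invfM; ring.
  have K3 : left_weight q p z true true * left_weight q p u true true =
      (T^-1 - u ^+ 2) * (T^-1 - z ^- 2) / 3%:R.
    apply: sigma_div_mul.
    have -> : sigma (q ^+ 2 * z ^+ 2) = u ^+ 2 - u ^- 2.
      have -> : q ^+ 2 * z ^+ 2 = - u ^- 2.
        rewrite zE; transitivity (q ^+ 6 / u ^+ 2); first by field.
        by rewrite q6E; ring.
      by rewrite /sigma invrN invrK; ring.
    rewrite /T /sigma (invfM (q ^+ 2)) (invfM (q ^+ 4)) qV2E qV4E zE.
    have -> : (q ^+ 2 / u) ^- 2 = - q ^+ 2 * u ^+ 2.
      by rewrite -qV4E; field; rewrite q0 u0.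
    ring.
  transitivity ((left_weight q p z true true * left_weight q p u true true) *
     (sigma (q ^+ 2 * (z * p)) / sigma (q ^+ 4) *
      (sigma (p^-1 * u) / sigma (q ^+ 2))) *
     (sigma (q ^+ 2 * (u * p)) / sigma (q ^+ 4) *
      right_weight q p u true false) * (A * B) * product_formula us); first by ring.
  by rewrite K1 K2 K3 -exprVn; ring.
have zE : z = q ^- 2 / u.
  by rewrite -[q ^- 2]mul1r -zu !mulfK ?expf_neq0.
rewrite (@product_formula_cons2 _ _ _ (q ^- 4)) ?qV4_root ?qV4_neq1 //; last first.
  by rewrite zE; field; rewrite q0 u0.
rewrite Zup_cons2_left ?sigma_q4_neq0 ?sigma_q2_neq0 // IH !prod_mirror.
set T := q ^- 4 * u ^+ 2.
have -> : \prod_(t <- us) ((T + T^-1 - t ^+ 2 - t ^- 2) / 3%:R) ^+ 2 =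
  \prod_(t <- us) (sigma (q ^+ 2 / (z * t)) / sigma (q ^+ 4)) ^+ 2 *
  \prod_(t <- us) (sigma (q ^+ 2 / (u * t)) / sigma (q ^+ 4)) ^+ 2.
  rewrite -big_split; apply: eq_big_seq => t tus /=.
  have t0 : t != 0 by apply: (allP us0).
  rewrite sigma_q4; symmetry; apply: s9.
  rewrite sigma_mul ?mulf_neq0 ?invr_eq0 ?mulf_neq0 //.
  have -> : q ^+ 2 / (z * t) * (q ^+ 2 / (u * t)) = - t ^- 2.
    rewrite zE; transitivity (q ^+ 6 / t ^+ 2); first by field; rewrite q0 u0 t0.
    by rewrite q6E; ring.
  have -> : q ^+ 2 / (z * t) / (q ^+ 2 / (u * t)) = - T.
    rewrite zE /T; transitivity (u ^+ 2 * q ^+ 6 / q ^+ 4).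
      by field; rewrite q0 u0 t0.
    by rewrite q6E; ring.
  have -> : q ^+ 2 / (u * t) / (q ^+ 2 / (z * t)) = - T^-1.
    rewrite zE /T; transitivity (q ^+ 4 / u ^+ 2 / q ^+ 6).
      by field; rewrite q0 u0 t0.
    by rewrite q6E invrN1 invfM invrK; ring.
  by rewrite invrN invrK; ring.
set A := \prod_(t <- us) _; set B := \prod_(t <- us) _.
have K1 : sigma (p * u^-1) / sigma (q ^+ 2) *
    (sigma (q ^+ 2 / (z * p)) / sigma (q ^+ 4)) = boundary_factor z / 3%:R.
  rewrite sigma_q4; apply: sigma_div_mul; rewrite -boundary_factor_sigma //.
  by congr (sigma _ * _); rewrite zE; field; rewrite q0 u0.
have K2 : left_weight q p u true false *
    (sigma (q ^+ 2 / (u * p)) / sigma (q ^+ 4)) = boundary_factor u / 3%:R.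
  rewrite sigma_q4; apply: sigma_div_mul; rewrite -boundary_factor_sigma //.
  by congr (sigma _ * _); ring.
have K3 : right_weight q p z true true * right_weight q p u true true =
    (T^-1 - u ^+ 2) * (T^-1 - z ^- 2) / 3%:R.
  apply: sigma_div_mul.
  have -> : sigma (q ^+ 2 * z^-1 ^+ 2) = u ^- 2 - u ^+ 2.
    have -> : q ^+ 2 * z^-1 ^+ 2 = - u ^+ 2.
      rewrite zE; transitivity (q ^+ 6 * u ^+ 2); first by field; rewrite q0 u0 oner_neq0.
      by rewrite q6E; ring.
    by rewrite /sigma invrN; ring.
  rewrite /T /sigma exprVn (invfM (q ^+ 2)) (invfM (q ^- 4)) qV2E !invrK zE.
  have -> : (q ^- 2 / u) ^- 2 = q ^+ 4 * u ^+ 2.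
    by field; rewrite q0 u0 oner_neq0.
  transitivity ((u ^- 2 - u ^+ 2) * (q ^+ 2 / u ^+ 2 + q ^+ 4 * u ^+ 2)).
    by ring.
  transitivity (- ((q ^+ 6 * q ^+ 2 / u ^+ 2 - q ^+ 4 * u ^+ 2)
    * (u ^- 2 - u ^+ 2))); last by ring.
  by rewrite q6E; ring.
transitivity ((right_weight q p z true true * right_weight q p u true true) *
   (sigma (p * u^-1) / sigma (q ^+ 2) *
    (sigma (q ^+ 2 / (z * p)) / sigma (q ^+ 4))) *
   (left_weight q p u true false *
    (sigma (q ^+ 2 / (u * p)) / sigma (q ^+ 4))) * (A * B) * product_formula us).
  by ring.
by rewrite K1 K2 K3 -exprVn; ring.
Qed.

End RootOfUnity.

Lemma uniq_map_inj (T1 T2 : eqType) (f : T1 -> T2) s :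
  uniq (map f s) -> {in s &, injective f}.
Proof.
elim: s => // x s IH /= /andP[fx /IH fs] y z.
rewrite !inE => /predU1P[-> | ys] /predU1P[-> | zs] // fyz; last exact: fs.
  by rewrite fyz map_f in fx.
by rewrite -fyz map_f in fx.
Qed.

(** * Interpolation *)

Section Generic.
Variable K : fieldType.
Implicit Types (us : seq K).

Lemma with_inverses_cat (s1 s2 : seq K) :
  with_inverses (s1 ++ s2) = with_inverses s1 ++ with_inverses s2.
Proof. by rewrite /with_inverses map_cat flatten_cat. Qed.

Lemma perm_with_inverses (s1 s2 : seq K) :
  perm_eq s1 s2 -> perm_eq (with_inverses s1) (with_inverses s2).
Proof. by move=> s12; rewrite perm_flatten // perm_map. Qed.

Lemma mem_with_inverses (s : seq K) y : y \in s ->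
  (y \in with_inverses s) && (y^-1 \in with_inverses s).
Proof.
elim: s => //= x s IH; rewrite !inE => /predU1P[-> | /IH/andP[-> ->]].
  by rewrite !eqxx !orbT.
by rewrite !orbT.
Qed.

(* 24th powers kill the roots of unity by which the arguments are compared. *)
Definition generic us :=
  all (fun u => u != 0) us && uniq (1 :: with_inverses [seq u ^+ 24 | u <- us]).

Lemma generic_perm us1 us2 : perm_eq us1 us2 -> generic us1 = generic us2.
Proof.
move=> us12; rewrite /generic (perm_all _ us12); congr (_ && _).
by apply: perm_uniq; rewrite perm_cons perm_with_inverses // perm_map.
Qed.

Lemma generic_cat us1 us2 : generic (us1 ++ us2) -> generic us2.
Proof.
rewrite /generic all_cat map_cat with_inverses_cat /= mem_cat negb_or cat_uniq.
by case/andP=> /andP[_ ->] /andP[/andP[_ ->] /and3P[_ _ ->]].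
Qed.

Lemma generic_cons u us : generic (u :: us) ->
  [/\ u != 0, u ^+ 24 != 1, generic us & forall w, w \in us ->
    [/\ w != 0, w ^+ 24 != u ^+ 24 & w ^+ 24 * u ^+ 24 != 1]].
Proof.
move=> gu; have := gu; rewrite /generic /= !inE !negb_or.
case/andP=> /andP[u0 us0] /and3P[/and3P[u1 _ _] /andP[_ unin] /andP[u'nin _]].
split=> //; [by rewrite eq_sym | exact: (@generic_cat [:: u]) | ].
move=> w wus; have w0 : w != 0 by apply: (allP us0).
have /andP[w1 w2] := @mem_with_inverses [seq u ^+ 24 | u <- us] _ (map_f _ wus).
split=> //; first by apply: contraNneq unin => <-.
apply: contraNneq u'nin => wu1.
by rewrite -[_^-1]mul1r -wu1 mulfK ?expf_neq0.
Qed.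

Local Notation squares us := (with_inverses [seq u ^+ 2 | u <- us]).

Lemma map_squares us :
  [seq y ^+ 12 | y <- squares us] = with_inverses [seq u ^+ 24 | u <- us].
Proof. by elim: us => //= u us ->; rewrite exprVn -exprM. Qed.

Lemma generic_uniq_squares us : (1 : K) != -1 -> generic us ->
  uniq [:: 1, -1 & squares us].
Proof.
move=> m1 /andP[_]; rewrite -map_squares /= => /andP[n1 /map_uniq->].
have nin (e : K) : e ^+ 12 = 1 -> e \notin squares us.
  by move=> e12; apply: contra n1 => /(map_f (fun y => y ^+ 12)); rewrite e12.
rewrite inE negb_or m1 !nin ?expr1n //.
by rewrite -[12%N]/(2 * 6)%N exprM sqrrN !expr1n.
Qed.

Lemma generic_map (I : eqType) (x : I -> K) (ks : seq I) :
  (forall k, x k != 0) -> (forall k l, x k ^+ 24 * x l ^+ 24 != 1) ->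
  (forall k l, k != l -> x k ^+ 24 != x l ^+ 24) ->
  uniq ks -> generic [seq x k | k <- ks].
Proof.
move=> x0 xM1 x_inj uks; apply/andP; split; first by apply/allP => _ /mapP[k _ ->].
have neqV k l : x k ^+ 24 != (x l ^+ 24)^-1.
  by apply: contraNneq (xM1 k l) => ->; rewrite mulVf // expf_neq0.
have neq1 k : x k ^+ 24 != 1.
  by apply: contraNneq (xM1 k k) => ->; rewrite mulr1.
elim: ks uks => //= k ks IH /andP[kks /IH /andP[one_nin uks]].
have notin y : (forall l, l \in ks -> (y != x l ^+ 24) && (y != (x l ^+ 24)^-1)) ->
    y \notin with_inverses [seq w ^+ 24 | w <- [seq x l | l <- ks]].
  elim: (ks) => //= l ls IHl H; rewrite !inE !negb_or.
  have /andP[-> ->] := H l (mem_head _ _); apply: IHl => m mls; apply: H.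
  by rewrite inE mls orbT.
have kl l : l \in ks -> k != l by move=> lks; apply: contraNneq kks => ->.
rewrite uks !inE !negb_or one_nin neqV ![1 == _]eq_sym invr_eq1 !neq1 /= andbT.
rewrite !notin // => l lks.
  by rewrite [_ == x l ^+ 24]eq_sym neqV (inj_eq invr_inj) x_inj ?kl.
by rewrite x_inj ?kl ?neqV.
Qed.

End Generic.

(** * Special points and the induction *)

Section MainFormula.
Variables (K : fieldType) (q p : K).
Hypothesis q4E : q ^+ 4 = q ^+ 2 - 1.
Hypothesis two_neq0 : (2%:R : K) != 0.
Hypothesis three_neq0 : (3%:R : K) != 0.

Implicit Types (u z t : K) (us : seq K).

Local Notation squares us := (with_inverses [seq u ^+ 2 | u <- us]).
Local Notation Zup := (Zup q p p).
Local Notation boundary_factor := (boundary_factor p).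
Local Notation product_formula := (product_formula p).
Local Notation q0 := (q_neq0 q4E).

Lemma product_formula_perm us1 us2 : perm_eq us1 us2 ->
  product_formula us1 = product_formula us2.
Proof.
move=> us12; rewrite /product_formula (perm_size us12) (perm_big _ us12).
congr (_ * _); apply: staircase_schur_perm; first by rewrite size_squares.
by rewrite perm_with_inverses // perm_map.
Qed.

Lemma sigma_neq0 (y : K) : y != 0 -> y ^+ 2 != 1 -> sigma y != 0.
Proof.
move=> y0 y2; have -> : sigma y = (y ^+ 2 - 1) / y by rewrite /sigma; field.
by rewrite mulf_neq0 ?invr_eq0 // subr_eq0.
Qed.

Lemma q24E : q ^+ 24 = 1.
Proof. by rewrite (exprM _ 6 4) q6E //; ring. Qed.

(* Where a corner weight with two outgoing edges vanishes, so that the row of z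
   is frozen. *)
Definition freezing_points := [:: q; q^-1; q ^+ 2; q ^- 2].

Definition crossing_points (ts : seq K) :=
  flatten [seq [:: q ^+ 2 / t; q ^- 2 / t] | t <- ts].

Lemma mem_crossing_points ts z : z \in crossing_points ts ->
  exists2 t, t \in ts & z = q ^+ 2 / t \/ z = q ^- 2 / t.
Proof.
elim: ts => //= t ts IH; rewrite !inE => /or3P[/eqP->|/eqP->|/IH[t' t'ts zt']].
- by exists t; rewrite ?mem_head //; left.
- by exists t; rewrite ?mem_head //; right.
- by exists t'; rewrite ?inE ?t'ts ?orbT.
Qed.

(** Twelfth powers of the squares tell the special points apart: 1 for the freezing points, t ^ -24
    for the crossing points of t. *)
Lemma freezing_points_pow z : z \in freezing_points -> (z ^+ 2) ^+ 12 = 1.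
Proof.
rewrite -exprM !inE => /or4P[] /eqP->; rewrite ?exprVn -?exprM ?q24E ?invr1 //;
by rewrite (exprM _ 24 2) q24E ?expr1n ?invr1.
Qed.

Lemma crossing_points_pow t z : z = q ^+ 2 / t \/ z = q ^- 2 / t ->
  (z ^+ 2) ^+ 12 = t ^- 24.
Proof.
rewrite -exprM; case=> ->; rewrite exprMn !exprVn -exprM ?exprVn.
  by rewrite (exprM _ 24 2) q24E expr1n mul1r.
by rewrite (exprM _ 24 2) q24E expr1n invr1 mul1r.
Qed.

Lemma q2_neq1 : q ^+ 2 != 1.
Proof.
apply: contra_eq_neq q4E => q2; rewrite (exprM _ 2 2) q2 expr1n subrr.
exact: oner_neq0.
Qed.

Lemma q2_neqN1 : q ^+ 2 != -1.
Proof.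
apply: contra_eq_neq q4E => q2; rewrite (exprM _ 2 2) q2 sqrrN expr1n.
by rewrite -subr_eq0 (_ : 1 - (-1 - 1) = 3%:R) //; ring.
Qed.

Lemma one_neqN1 : (1 : K) != -1.
Proof. by rewrite -subr_eq0 opprK. Qed.

Lemma q4_neq_q2 : q ^+ 4 != q ^+ 2.
Proof.
rewrite (exprD _ 2 2) -[X in _ != X]mulr1 (inj_eq (mulfI _)) ?q2_neq1 //.
by rewrite expf_neq0 ?q0.
Qed.

Lemma q4_neqN_q2 : q ^+ 4 != - q ^+ 2.
Proof.
rewrite (exprD _ 2 2) -[X in - X]mulr1 -mulrN (inj_eq (mulfI _)) ?q2_neqN1 //.
by rewrite expf_neq0 ?q0.
Qed.

Lemma uniq_freezing_points : uniq [seq z ^+ 2 | z <- freezing_points].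
Proof.
have q20 : q ^+ 2 != 0 by rewrite expf_neq0 ?q0.
have N (x : K) : x != 0 -> x != - x.
  move=> x0; rewrite -subr_eq0 opprK (_ : x + x = 2%:R * x); last by ring.
  by rewrite mulf_neq0.
rewrite /= !inE !exprVn -!exprM (qV2E q4E) (qV4E q4E) !negb_or.
rewrite -[(2 * 2)%N]/4%N eqr_opp.
have n1 : q ^+ 2 != q ^+ 4 by rewrite eq_sym q4_neq_q2.
have n2 : q ^+ 2 != - q ^+ 4 by rewrite eq_sym eqr_oppLR q4_neqN_q2.
have n4 : - q ^+ 4 != q ^+ 4 by rewrite eq_sym N ?expf_neq0 ?q0.
by rewrite n1 n2 n4 N // q4_neq_q2 q4_neqN_q2.
Qed.

Lemma uniq_crossing_points ts : generic ts ->
  uniq [seq z ^+ 2 | z <- crossing_points ts].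
Proof.
elim: ts => //= t ts IH /generic_cons[t0 t1 /IH uts tts].
have nin z : z = q ^+ 2 / t \/ z = q ^- 2 / t ->
    z ^+ 2 \notin [seq z ^+ 2 | z <- crossing_points ts].
  move=> zt; apply/negP => /mapP[z' /mem_crossing_points[t' t'ts zt'] zz'].
  have [t'0 /eqP tt' _] := tts t' t'ts; apply: tt'.
  apply: invr_inj; rewrite -(crossing_points_pow zt') -(crossing_points_pow zt).
  by rewrite zz'.
rewrite uts nin; last by right.
rewrite inE negb_or nin ?andbT /=; last by left.
rewrite !exprMn !exprVn -!exprM -subr_eq0 -mulrBl mulf_neq0 ?invr_eq0 ?expf_neq0 //.
by rewrite -exprD -[(2 * 2)%N]/4%N qV4E // subr_eq0 q4_neqN_q2.
Qed.

(** [p] is listed with [us] as the parameter of the central column; at its two crossing points both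
    sides vanish. *)
Definition special_points us := freezing_points ++ crossing_points (p :: us).

Lemma uniq_special_points us : generic (p :: us) ->
  uniq [seq z ^+ 2 | z <- special_points us].
Proof.
move=> gus; rewrite map_cat cat_uniq uniq_freezing_points uniq_crossing_points //.
rewrite andbT; apply/hasPn => _ /mapP[z /mem_crossing_points[t tus zt] ->].
apply/negP => /mapP[z' /freezing_points_pow z'1 zz'].
have /eqP := crossing_points_pow zt; rewrite zz' z'1 eq_sym invr_eq1.
apply/negP; have /andP[_ /= /andP[n1 _]] := gus; apply: contraNneq n1 => <-.
by case/andP: (mem_with_inverses (map_f (fun u => u ^+ 24) tus)).
Qed.

(** At a special point [z :: us] is not generic. What is kept is that the arguments of the Schur
    function are distinct, so that its denominator does not vanish. *)
Lemma special_points_generic us z : generic (p :: us) -> z \in special_points us ->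
  [/\ z != 0, (z ^+ 2) ^+ 2 != 1 & z ^+ 2 \notin squares us].
Proof.
move=> gus zs; have := gus; rewrite /generic -map_squares => /andP[nz0].
rewrite /= !inE !negb_or => /andP[/and3P[np1 _ n1] /and3P[pnin p'nin uus]].
have mem12 (x : K) : x \in squares us -> x ^+ 12 \in [seq y ^+ 12 | y <- squares us].
  exact: map_f.
move: zs; rewrite mem_cat => /orP[zf | /mem_crossing_points[t tus zt]].
  have zp := freezing_points_pow zf; split.
  - move: zf; rewrite !inE => /or4P[] /eqP->; by rewrite ?invr_eq0 ?expf_neq0 ?q0.
  - move: zf; rewrite !inE -exprM => /or4P[] /eqP->;
    rewrite ?exprVn -?exprM ?invr_eq1 ?q4_neq1 //.
    by rewrite (exprD _ 6 2) q6E // mulN1r eqr_oppLR q2_neqN1.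
    by rewrite (exprD _ 6 2) q6E // mulN1r eqr_oppLR q2_neqN1.
  - by apply: contra n1 => h; rewrite -zp mem12.
have t0 : t != 0 by apply: (allP nz0).
have zp := crossing_points_pow zt.
have t1 : t ^+ 24 != 1.
  have /andP[_ /= /andP[n1' _]] := gus; apply: contraNneq n1' => <-.
  by case/andP: (mem_with_inverses (map_f (fun u => u ^+ 24) tus)).
split.
- by case: zt => ->; rewrite mulf_neq0 ?invr_eq0 ?expf_neq0 ?q0.
- apply: contraNneq t1 => z2.
  by rewrite -[_ ^+ 24]invrK -zp (exprM _ 2 6) z2 expr1n invr1.
apply/negP => zus; have := mem12 _ zus; rewrite zp.
move: tus; rewrite inE => /predU1P[-> | tus].
  by apply/negP; move: p'nin; rewrite exprVn -exprM.
have /andP[_ t'us] := mem_with_inverses (map_f (fun u => u ^+ 2) tus).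
(* Twelfth powers separate the squares, so z ^ 2 would be t ^ -2, whereas (z t) ^ 2 is q ^ 4 or q ^
   -4. *)
move=> _; have zt2 : z ^+ 2 = (t ^+ 2)^-1.
  by apply: (uniq_map_inj uus zus t'us); rewrite zp exprVn -exprM.
have : (z * t) ^+ 2 = 1 by rewrite exprMn zt2 mulVf ?expf_neq0.
case: zt => ->; rewrite mulfVK // ?exprVn -exprM => /eqP.
  by apply/negP; rewrite q4_neq1.
by rewrite invr_eq1; apply/negP; rewrite q4_neq1.
Qed.

Lemma uniq_squares_cons z us : generic us -> z != 0 -> (z ^+ 2) ^+ 2 != 1 ->
  z ^+ 2 \notin squares us -> uniq (squares (z :: us)).
Proof.
move=> gus z0 z4 zus; have /= /and3P[_ _ uus] := generic_uniq_squares one_neqN1 gus.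
rewrite /= inE negb_or zus uus !andbT; apply/andP; split.
  apply: contra z4 => /eqP zz; rewrite expr2 [X in X * _]zz.
  by rewrite mulVf ?expf_neq0.
by apply: contra zus => /with_inverses_inv; rewrite invrK.
Qed.

Lemma boundary_factor_eq0 z : p != 0 -> z = q ^+ 2 / p \/ z = q ^- 2 / p ->
  boundary_factor z = 0.
Proof.
move=> p0 zp; have -> : boundary_factor z = (z * p) ^+ 2 + 1 + (z * p) ^- 2.
  by rewrite /boundary_factor exprMn (invfM (z ^+ 2)); ring.
case: zp => ->; rewrite mulfVK // ?exprVn ?invrK -!exprM.
  by rewrite (qV4E q4E) -[(2 * 2)%N]/4%N q4E; ring.
by rewrite (qV4E q4E) -[(2 * 2)%N]/4%N q4E; ring.
Qed.

Hypothesis p0 : p != 0.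

Local Notation sq2_neq0 := (sigma_q2_neq0 q4E three_neq0).
Local Notation sq4_neq0 := (sigma_q4_neq0 q4E three_neq0).

(** Since q ^ 24 = 1, a zero of the scalar [sigma (q ^+ 4 * w / u)] would make the 24th powers of
    [w] and [u] equal. *)
Lemma Zup_move_generic us1 us2 us3 u :
  all (fun t => t != 0) (us1 ++ u :: us2 ++ us3) ->
  (forall w, w \in us2 -> w ^+ 24 != u ^+ 24) ->
  Zup (us1 ++ u :: us2 ++ us3) = Zup (us1 ++ us2 ++ u :: us3).
Proof.
move=> nz wu; apply: Zup_move => //; rewrite ?q0 ?sq2_neq0 ?sq4_neq0 //.
apply/allP => w wus; have w0 : w != 0.
  by apply: (allP nz); rewrite mem_cat inE mem_cat wus !orbT.
have u0 : u != 0 by apply: (allP nz); rewrite mem_cat mem_head orbT.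
apply: sigma_neq0; first by rewrite !mulf_neq0 ?invr_eq0 ?expf_neq0 ?q0.
apply: contra (wu w wus) => /eqP/(congr1 (fun x => x ^+ 12)) /=.
have -> : (q ^+ 4 * w / u) ^+ 2 ^+ 12 = (q ^+ 24) ^+ 4 * (w ^+ 24 / u ^+ 24).
  by rewrite -exprM; field.
rewrite q24E // !expr1n mul1r => /(canRL (mulfVK (expf_neq0 _ u0))) ->.
by rewrite mul1r.
Qed.

Lemma Zup_special us z : generic (p :: us) -> z \in special_points us ->
  (forall us', (size us' <= size us)%N -> generic (p :: us') ->
     Zup us' = product_formula us') ->
  Zup (z :: us) = product_formula (z :: us).
Proof.
move=> gpus zs IH; have [z0 z4 zus] := special_points_generic gpus zs.
have [_ _ gus pus] := generic_cons gpus.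
have nz : all (fun t => t != 0) us by case/andP: gus.
have uz := uniq_squares_cons gus z0 z4 zus.
have pe1 : (1 : K) ^+ 2 = 1 by rewrite expr1n.
have pe2 : (-1 : K) ^+ 2 = 1 by rewrite sqrrN expr1n.
move: zs; rewrite mem_cat => /orP[zf | /mem_crossing_points[t tus zt]].
  have [e e2 ze] : exists2 e, e ^+ 2 = 1 & z ^+ 2 * q ^+ 2 = e \/ z ^+ 2 = e * q ^+ 2.
    move: zf; rewrite !inE => /or4P[] /eqP->.
    - by exists 1; rewrite ?mul1r //; right.
    - by exists 1; rewrite ?exprVn ?mulVf ?expf_neq0 ?q0 //; left.
    - by exists (-1) => //; left; rewrite -exprM -exprD q6E.
    - by exists (-1) => //; right; rewrite exprVn -exprM (qV4E q4E) mulN1r.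
  by apply: Zup_cons_special ze uz _ => //; apply: IH.
move: tus; rewrite inE => /predU1P[tp | tus].
  rewrite tp in zt.
  have bz := boundary_factor_eq0 p0 zt.
  have := @Zup_move_generic [::] us [::] z; rewrite /= cats0 cats1 => ->.
  - rewrite /Zup Zrec_rcons_eq0 ?sq2_neq0 ?sq4_neq0 ?q0 //.
    + by rewrite /product_formula big_cons bz mul0r mulr0 mul0r.
    + by rewrite boundary_factor_sigma // bz oppr0.
    + by rewrite size_nseq size_rcons; clear; lia.
  - by rewrite z0.
  move=> w wus; have [_ _] := pus w wus; apply: contraNneq => ->.
  by rewrite -[24%N]/(2 * 12)%N exprM (crossing_points_pow zt) mulVf ?expf_neq0.
case/splitPr: tus gpus IH gus pus nz uz zus => us1 us2 gpus IH gus pus nz uz zus.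
have pe s : perm_eq (s ++ t :: us1 ++ us2) (s ++ us1 ++ t :: us2).
  by rewrite perm_cat2l -cat1s -[t :: us2]cat1s perm_catCA.
have gt : generic (t :: us1 ++ us2) by rewrite (generic_perm (pe [::])).
have [t0 _ gus' tus] := generic_cons gt.
(* The row of [z] stays first and that of [t] is moved up to it, past [us1]. *)
have -> : Zup (z :: us1 ++ t :: us2) = Zup (z :: t :: us1 ++ us2).
  rewrite -(@Zup_move_generic [:: z] us1 us2 t) //.
    by rewrite (perm_all _ (pe [:: z])) /= z0.
  by move=> w wus; have [] := tus w; rewrite // mem_cat wus.
rewrite -(product_formula_perm (pe [:: z])).
apply: Zup_cons2_special => //.
- by case/andP: gus'.
- by rewrite (perm_uniq (perm_with_inverses (perm_map _ (pe [:: z])))).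
- case: zt => ->; first by left; rewrite mulfVK.
  by right; rewrite mulfVK // mulVf ?expf_neq0 ?q0.
apply: IH; first by rewrite !size_cat /=; clear; lia.
apply: (@generic_cat _ [:: t]).
rewrite -(generic_perm (_ : perm_eq (p :: us1 ++ t :: us2) _)) //.
rewrite perm_sym; apply: perm_trans (pe [:: p]).
by rewrite (perm_catCA [:: t] [:: p]).
Qed.

Lemma Zup_nil : Zup [::] = product_formula [::].
Proof.
rewrite /product_formula /staircase_schur /alternant /vdm /det_fun /=.
by rewrite det_mx00 big_ord0 big_nil bin_small // expr0 invr1 !mulr1.
Qed.

(* As functions of u ^ 2 both sides are polynomials of degree at most
   2 n + 2, n = size us + 1, that agree at the 2 n + 4 special points. *)
Theorem Zup_formula us : generic (p :: us) -> Zup us = product_formula us.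
Proof.
have [n] := ubnP (size us); elim: n us => // n IHn [|u us] /=.
  by move=> _ _; exact: Zup_nil.
rewrite ltnS => leus gpus.
have gpus' : generic (p :: us).
  apply: (@generic_cat _ [:: u]).
  rewrite -(generic_perm (_ : perm_eq [:: p, u & us] _)) //.
  by rewrite (perm_catCA [:: p] [:: u]).
have gus : generic us := generic_cat (us1 := [:: p]) gpus'.
have gu : generic (u :: us) := generic_cat (us1 := [:: p]) gpus.
have IH us' : (size us' <= size us)%N -> generic (p :: us') ->
   Zup us' = product_formula us'.
  by move=> leus'; apply: IHn; apply: leq_ltn_trans leus' leus.
have nz : all (fun t => t != 0) us by case/andP: gus.
have [u0 u24 _ usu] := generic_cons gu.
have [P sP PE] := laurent_Zup q0 p0 nz.
have [|Q sQ QE] := @staircase_schur_poly _ (size us) [seq t ^+ 2 | t <- us]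
   (size_map _ _) _ (generic_uniq_squares one_neqN1 gus).
  by rewrite all_map; apply: sub_all nz => t t0 /=; rewrite expf_neq0.
pose c := 3%:R ^- 'C((size us).+2, 2) * \prod_(t <- us) boundary_factor t.
(* In X = z ^ 2 the quadratic factor is X times [boundary_factor z]; with [Q] the degree is at most
   2 + (2 * size us + 2). *)
pose P' := c *: ((p ^+ 2 *: 'X^2 + 'X + (p ^- 2)%:P) * Q).
have P'E z : z != 0 -> (z ^+ 2) ^+ 2 != 1 -> z ^+ 2 \notin squares us ->
    z ^+ (2 * size us + 4) * product_formula (z :: us) = P'.[z ^+ 2].
  move=> z0 z4 zus; have z20 : z ^+ 2 != 0 by rewrite expf_neq0.
  have -> : product_formula (z :: us) = 3%:R ^- 'C((size us).+2, 2) *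
     (boundary_factor z * \prod_(t <- us) boundary_factor t) *
     staircase_schur (size us).+1 [:: z ^+ 2, (z ^+ 2)^-1 & squares us].
    by rewrite /product_formula big_cons.
  have -> : z ^+ (2 * size us + 4) = (z ^+ 2) ^+ (size us).+1 * z ^+ 2.
    by rewrite -exprM -exprD; congr (_ ^+ _); clear; lia.
  have := QE _ z20 z4 zus; move: (staircase_schur _ _) => S QE'.
  rewrite /P' hornerZ hornerM -QE' !hornerE /= /c.
  move: (\prod_(t <- us) _) (_ ^- _) (_ ^+ (size us).+1) => A C Z.
  by rewrite /boundary_factor; field; rewrite z0 p0.
have sPP' : (size (P - P')%R <= 2 * size us + 5)%N.
  apply: (leq_trans (size_polyD _ _)); rewrite size_polyN geq_max.
  rewrite (leq_trans sP) ?(leq_trans (size_scale_leq _ _)) //; try (clear; lia).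
  apply: (leq_trans (size_polyMleq _ _)).
  have : (size (p ^+ 2 *: 'X^2 + 'X + (p ^- 2)%:P)%R <= 3)%N.
    apply: (leq_trans (size_polyD _ _)); rewrite geq_max.
    rewrite (leq_trans (size_polyC_leq1 _)) // andbT.
    apply: (leq_trans (size_polyD _ _)); rewrite geq_max size_polyX andbT.
    by rewrite (leq_trans (size_scale_leq _ _)) ?size_polyXn.
  by move=> sA; move: (leq_add sA sQ); move: (size _ + size _)%N => t; clear; lia.
have PP' : P = P'.
  apply/eqP; rewrite -subr_eq0; apply/negPn/negP => PP0.
  have := @max_poly_roots _ _ [seq z ^+ 2 | z <- special_points us] PP0.
  have -> : size [seq z ^+ 2 | z <- special_points us] = (2 * size us + 6)%N.
    rewrite size_map size_cat; have -> ts : size (crossing_points ts) = (2 * size ts)%N.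
      by elim: ts => //= t ts ->; clear; lia.
    by rewrite /=; clear; lia.
  rewrite uniq_special_points // => H; suff : (2 * size us + 6 < size (P - P')%R)%N.
    by rewrite ltnNge (leq_trans sPP') // leq_add2l.
  apply: H => //; apply/allP => _ /mapP[z zs ->].
  have [z0 z4 zus] := special_points_generic gpus' zs.
  by rewrite rootE hornerD hornerN -PE // -P'E // Zup_special // subrr.
have u4 : (u ^+ 2) ^+ 2 != 1.
  by apply: contraNneq u24 => u4; rewrite (exprM u 2 12) (exprM _ 2 6) u4 expr1n.
have uus : u ^+ 2 \notin squares us.
  have /and3P[_ _] := generic_uniq_squares one_neqN1 gu.
  by rewrite /= inE negb_or => /andP[/andP[_ ->]].
apply: (mulfI (expf_neq0 (2 * size us + 4) u0)).
by rewrite PE // PP' P'E.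
Qed.

End MainFormula.

(** * Configurations as bit sequences *)

Section SumRows.
Variable K : fieldType.

(** On a duplicate-free list, [mask] is a bijection from bit sequences to subsets. *)
Lemma sum_subset_bits (T : finType) (es : seq T) (F : {set T} -> K) : uniq es ->
  \sum_(V : {set T} | V \subset [set x in es]) F V =
  sum_bits (size es) (fun bs => F [set x in mask bs es]).
Proof.
elim: es F => [|x es IH] F /=.
  move=> _; rewrite (big_pred1 set0) => [|V]; last first.
    by rewrite (_ : [set x in [::]] = set0) ?subset0 //; apply/setP => y; rewrite !inE.
  by congr F; apply/setP => y; rewrite !inE.
case/andP=> xes ues; rewrite big_bool /= (bigID (fun V : {set T} => x \in V)) /=.
congr (_ + _).
  rewrite (reindex_onto (fun V => x |: V) (fun V => V :\ x)) /=; last first.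
    by move=> V /andP[_ xV]; rewrite setD1K.
  rewrite (eq_bigl (fun V : {set T} => V \subset [set y in es])) => [|V].
    rewrite IH //; apply: eq_sum_bits => s _; congr F.
    by apply/setP => y; rewrite !inE.
  rewrite setU11 andbT; apply/andP/idP => [[Vsub /eqP VE]|Vsub].
    apply/subsetP => y yV; have := subsetP Vsub y; rewrite !inE yV orbT => /(_ isT).
    by case/predU1P=> // yx; move: yV; rewrite yx -VE !inE eqxx.
  split.
    apply/subsetP => y; rewrite !inE => /predU1P[->|/(subsetP Vsub)].
      by rewrite eqxx.
    by rewrite inE => ->; rewrite orbT.
  rewrite setU1K //; apply: contra xes => /(subsetP Vsub).
  by rewrite inE.
rewrite (eq_bigl (fun V : {set T} => V \subset [set y in es])) => [|V].
  by rewrite IH.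
apply/andP/idP => [[Vsub xV]|Vsub].
  apply/subsetP => y yV; have := subsetP Vsub y yV; rewrite !inE.
  by case/predU1P=> // yx; rewrite -yx yV in xV.
split; first by apply/subsetP => y /(subsetP Vsub); rewrite !inE => ->; rewrite orbT.
by apply: contra xes => /(subsetP Vsub); rewrite inE.
Qed.

Fixpoint sum_rows (ms : seq nat) (F : seq (seq bool) -> K) : K :=
  if ms is m :: ms' then sum_bits m (fun s => sum_rows ms' (fun ss => F (s :: ss)))
  else F [::].

Lemma eq_sum_rows ms F G :
  (forall ss, shape ss = ms -> F ss = G ss) -> sum_rows ms F = sum_rows ms G.
Proof.
elim: ms F G => [|m ms IH] F G FG /=; first exact: FG.
apply: eq_sum_bits => s ss; apply: IH => ss' sss'; apply: FG.
by rewrite /= ss sss'.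
Qed.

Lemma sum_rows_cons m ms F :
  sum_rows (m :: ms) F = sum_bits m (fun s => sum_rows ms (fun ss => F (s :: ss))).
Proof. by []. Qed.

Lemma sum_bits_rows ms F :
  sum_bits (sumn ms) F = sum_rows ms (fun ss => F (flatten ss)).
Proof.
elim: ms F => //= m ms IH F; rewrite sum_bits_cat.
by apply: eq_sum_bits => s _; rewrite IH.
Qed.

Lemma sum_rowsZ ms c F : sum_rows ms (fun ss => c * F ss) = c * sum_rows ms F.
Proof.
elim: ms F => //= m ms IH F; rewrite -sum_bitsZ.
by apply: eq_sum_bits => s _; rewrite IH.
Qed.

Lemma nth_flatten_index (T : eqType) (rows : seq (seq T)) (ss : seq (seq bool)) x k :
  shape ss = shape rows -> x \in nth [::] rows k ->
  (forall l, (l < k)%N -> x \notin nth [::] rows l) ->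
  nth false (flatten ss) (index x (flatten rows)) =
  nth false (nth [::] ss k) (index x (nth [::] rows k)).
Proof.
elim: rows ss k => [|r rows IH] [|s ss] [|k] //= [szs shp] xk xl.
  rewrite index_cat xk nth_cat szs index_mem xk //.
rewrite index_cat (negPf (xl 0%N _)) // nth_cat szs.
rewrite ltnNge leq_addr /= addKn; apply: IH => // l lk.
exact: (xl l.+1).
Qed.

End SumRows.

(** * The recursion unfolded into a sum over all edges *)

Section Frozen.
Variables (K : fieldType) (q p v : K).
Implicit Types (u z : K) (zs us : seq K) (e : bool) (t h bs : seq bool).

(* Weight of a row with horizontal edges h between the vertical edges t above
   and bs below. *)
Definition full_row u zs t h bs : K :=
  left_weight q p u (nth false t 0) (nth false h 0) *
  (\prod_(c < size zs) bulk_weight q (u * nth 0 zs c) (nth false t c.+1)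
     (nth false bs c) (nth false h c) (nth false h c.+1)) *
  right_weight q p u (nth false t (size zs).+1) (~~ nth false h (size zs)).

Lemma hline_full u zs e t bs : size t = (size zs).+1 -> size bs = size zs ->
  hline q u zs e t bs (right_end q p u) =
  sum_bits (size zs) (fun h =>
    (\prod_(c < size zs) bulk_weight q (u * nth 0 zs c) (nth false t c)
      (nth false bs c) (nth false (e :: h) c) (nth false h c)) *
    right_weight q p u (nth false t (size zs)) (~~ nth false (e :: h) (size zs))).
Proof.
elim: zs e t bs => [|z zs IH] e [|n t] [|s bs] //=.
  by case: t => //; rewrite big_ord0 mul1r.
move=> [st] [sb]; apply: eq_bigr => f _; rewrite IH // -sum_bitsZ.
by apply: eq_sum_bits => h _; rewrite big_ord_recl /= mulrA.
Qed.

Lemma row_weight_full u zs t bs : size t = (size zs).+2 -> size bs = size zs ->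
  row_weight q p u zs t bs = sum_bits (size zs).+1 (fun h => full_row u zs t h bs).
Proof.
case: t => // l t [st] sb; rewrite /row_weight /=; apply: eq_bigr => e _.
rewrite hline_full // -sum_bitsZ; apply: eq_sum_bits => h _.
by rewrite /full_row /= mulrA.
Qed.

Definition mirror_row us := us ++ v :: rev us.

Lemma size_mirror_row us : size (mirror_row us) = (2 * size us).+1.
Proof. by rewrite size_cat /= size_rev; lia. Qed.

(** [T] has one row more than [H]: its rows i and i + 1 lie above and below row i of the triangle,
    and its last row is the bottom edge. *)
Definition full_weight us (T H : seq (seq bool)) : K :=
  (\prod_(i < size us) full_row (nth v us i) (mirror_row (drop i.+1 us))
     (nth [::] T i) (nth [::] H i) (nth [::] T i.+1)) *
  (nth [::] T (size us) == [:: true])%:R.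

(** Here [m] is the number of rows still below; the top edges, fixed in advance, are left out. *)
Definition vsizes us := [seq (2 * m).+1 | m <- rev (iota 0 (size us))].
Definition hsizes us := [seq (2 * m).+2 | m <- rev (iota 0 (size us))].

Lemma Zrec_full us t : size t = (2 * size us).+1 ->
  Zrec q p v us t =
  sum_rows (vsizes us) (fun T => sum_rows (hsizes us) (fun H =>
    full_weight us (t :: T) H)).
Proof.
elim: us t => [|u us IH] t st.
  by rewrite /= /full_weight big_ord0 mul1r.
have revS m : rev (iota 0 m.+1) = m :: rev (iota 0 m).
  by rewrite -(addn1 m) iotaD rev_cat /= add0n.
have -> : vsizes (u :: us) = (2 * size us).+1 :: vsizes us by rewrite /vsizes /= revS.
have -> : hsizes (u :: us) = (2 * size us).+2 :: hsizes us by rewrite /hsizes /= revS.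
rewrite -[LHS]/(row_op q p u (mirror_row us) (Zrec q p v us) t).
rewrite sum_rows_cons /row_op size_mirror_row.
apply: eq_sum_bits => bs sb; rewrite IH //.
rewrite row_weight_full ?size_mirror_row //; last by rewrite st /=; lia.
rewrite -sum_rowsZ; apply: eq_sum_rows => T _; rewrite sum_rows_cons.
rewrite -sum_bitsZr; apply: eq_sum_bits => h _.
rewrite -sum_rowsZ; apply: eq_sum_rows => H _.
by rewrite /full_weight /= big_ord_recl /= drop0 mulrA.
Qed.

End Frozen.

(** * Enumeration of the edges of the graph *)

Section Rows.
Variable n : nat.

Definition vertex i j : grid n := (inord i, inord j).

(* In 1-based matrix coordinates, the first len i edges of row i + 1, which
   starts on the diagonal. *)
Definition edge_row (len : nat -> nat) i :=
  [seq vertex i.+1 (i.+1 + c) | c <- iota 0 (len i)].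

Definition edge_rows len N := [seq edge_row len i | i <- iota 0 N].

Variables (len : nat -> nat) (N : nat).
Hypothesis N_leq : (N <= n.+1)%N.
Hypothesis len_leq : forall i, (i < N)%N -> (i + len i <= 2 * n + 1)%N.

Lemma vertex_val i j : (i < n.+2)%N -> (j < (2 * n).+2)%N ->
  ((vertex i j).1 = i :> nat) * ((vertex i j).2 = j :> nat).
Proof. by move=> lei lej; rewrite /= !inordK. Qed.

Lemma vertexK (e : grid n) : vertex e.1 e.2 = e.
Proof. by rewrite /vertex !inord_val -surjective_pairing. Qed.

Lemma edge_vertex_val i c : (i < N)%N -> (c < len i)%N ->
  ((vertex i.+1 (i.+1 + c)).1 = i.+1 :> nat) *
  ((vertex i.+1 (i.+1 + c)).2 = (i.+1 + c)%N :> nat).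
Proof.
move=> iN cl; have := len_leq iN; have := N_leq => ? ?.
by apply: vertex_val; lia.
Qed.

Lemma edge_rows_nth i : (i < N)%N -> nth [::] (edge_rows len N) i = edge_row len i.
Proof. by move=> iN; rewrite (nth_map 0%N) ?size_iota // nth_iota. Qed.

Lemma mem_edge_row i e : (i < N)%N ->
  e \in edge_row len i = (e.1 == i.+1 :> nat) && (i < e.2 <= i + len i)%N.
Proof.
move=> iN; apply/mapP/idP => [[c]|].
  rewrite mem_iota => /andP[_ cl] ->; rewrite !edge_vertex_val // eqxx; lia.
case/andP=> /eqP e1 e2; exists (e.2 - i.+1)%N; first by rewrite mem_iota; lia.
by rewrite subnKC -?e1 ?vertexK //; lia.
Qed.

Lemma mem_edge_rows e : e \in flatten (edge_rows len N) =
  (0 < e.1 <= N)%N && (e.1 <= e.2 < e.1 + len (e.1.-1))%N.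
Proof.
apply/flatten_mapP/idP => [[k]|].
  rewrite mem_iota add0n => /andP[_ kN]; rewrite mem_edge_row //.
  by case/andP=> /eqP -> /=; lia.
move=> he; exists e.1.-1; first by rewrite mem_iota; lia.
by rewrite mem_edge_row; lia.
Qed.

Lemma uniq_edge_row i : (i < N)%N -> uniq (edge_row len i).
Proof.
move=> iN; rewrite map_inj_in_uniq ?iota_uniq // => c d.
rewrite !mem_iota => /andP[_ cl] /andP[_ dl] cd.
have := edge_vertex_val iN cl; rewrite cd !edge_vertex_val //; case=> _; lia.
Qed.

Lemma uniq_edge_rows : uniq (flatten (edge_rows len N)).
Proof.
have H M : (M <= N)%N -> uniq (flatten (edge_rows len M)).
  elim: M => // M IH MN; rewrite /edge_rows -(addn1 M) iotaD map_cat flatten_cat.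
  rewrite cat_uniq /= cats0 add0n uniq_edge_row // andbT IH; last by lia.
  apply/hasPn => e; rewrite mem_edge_row // => /andP[/eqP e1 _].
  apply/flatten_mapP => -[k]; rewrite mem_iota => kM.
  by rewrite mem_edge_row; lia.
exact: H.
Qed.

Lemma shape_edge_rows : shape (edge_rows len N) = [seq len i | i <- iota 0 N].
Proof.
rewrite /shape -map_comp; apply: eq_map => i /=.
by rewrite size_map size_iota.
Qed.

Lemma mem_mask_edge_rows (T : seq (seq bool)) i c :
  shape T = shape (edge_rows len N) -> (i < N)%N -> (c < len i)%N ->
  vertex i.+1 (i.+1 + c) \in mask (flatten T) (flatten (edge_rows len N)) =
  nth false (nth [::] T i) c.
Proof.
move=> shT iN cl; rewrite in_mask ?uniq_edge_rows //.
have vi : vertex i.+1 (i.+1 + c) \in edge_row len i.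
  by apply: map_f; rewrite mem_iota.
rewrite (_ : _ \in _ = true); last first.
  by apply/flatten_mapP; exists i => //; rewrite mem_iota.
rewrite (nth_flatten_index (k := i) shT) ?edge_rows_nth //.
  congr nth; rewrite -[X in vertex _ (_ + X)](nth_iota 0 0 cl).
  rewrite -(nth_map 0%N (vertex 0 0) (fun c => vertex i.+1 (i.+1 + c))) ?size_iota //.
  by rewrite index_uniq ?uniq_edge_row // size_map size_iota.
move=> l li; rewrite edge_rows_nth; last exact: ltn_trans li iN.
by rewrite mem_edge_row ?(ltn_trans li iN) // edge_vertex_val // eqSS gtn_eqF.
Qed.

End Rows.

Section FrozenPartitionFunction.
Variables (K : fieldType) (q p v : K) (n : nat) (u : 'I_n -> K).

Local Notation U := [seq u i | i <- enum 'I_n].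

(** The default value [v] of [nth] doubles as the parameter u_{n+1} of the central column. *)
Lemma spectralE k : spectral u v k = nth v U k.-1.
Proof.
rewrite /spectral; case: insubP => [i _ <- | ] /=.
  by rewrite (nth_map i) ?size_enum_ord // nth_ord_enum.
by rewrite -leqNgt => le; rewrite nth_default // size_map size_enum_ord.
Qed.

Lemma nth_mirror_row (us : seq K) c : (c <= 2 * size us)%N ->
  nth 0 (mirror_row v us) c = nth v us (minn c (2 * size us - c)).
Proof.
move=> cu; rewrite /mirror_row nth_cat; set m := size us in cu *.
have nthE k : (k < m)%N -> nth 0 us k = nth v us k by exact: set_nth_default.
case: ltnP => [cs | sc]; first by rewrite nthE //; congr nth; lia.
case E : (c - m)%N => [|d] /=.
  by rewrite nth_default // -/m; lia.
rewrite nth_rev -/m; last by lia.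
by rewrite nthE; [congr nth; lia | lia].
Qed.

(** Index [i] stands for row i + 1 of the graph, so row n of the vertical edges is the bottom edge
    alone. *)
Definition vlen i := (2 * (n - i)).+1.
Definition hlen i := (2 * (n - i))%N.

Lemma vlen_leq i : (i < n.+1)%N -> (i + vlen i <= 2 * n + 1)%N.
Proof. by rewrite /vlen; lia. Qed.

Lemma hlen_leq i : (i < n)%N -> (i + hlen i <= 2 * n + 1)%N.
Proof. by rewrite /hlen; lia. Qed.

Lemma is_vedgeE (e : grid n) :
  is_vedge n e.1 e.2 = (e \in flatten (edge_rows n vlen n.+1)).
Proof.
rewrite mem_edge_rows //; last exact: vlen_leq.
rewrite /is_vedge /is_vertex /vlen.
by case: (nat_of_ord e.1) (nat_of_ord e.2) => [|r] c //=; apply/idP/idP; lia.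
Qed.

Lemma is_hedgeE (e : grid n) :
  is_hedge n e.1 e.2 = (e \in flatten (edge_rows n hlen n)).
Proof.
rewrite mem_edge_rows //; last exact: hlen_leq.
rewrite /is_hedge /is_vertex /hlen.
by case: (nat_of_ord e.1) (nat_of_ord e.2) => [|r] c //=; apply/idP/idP; lia.
Qed.

Lemma size_U : size U = n.
Proof. by rewrite size_map size_enum_ord. Qed.

Lemma vsizesE : [seq vlen i | i <- iota 0 n.+1] = (2 * n).+1 :: vsizes U.
Proof.
rewrite /vsizes size_U /= /vlen subn0; congr (_ :: _).
apply: (@eq_from_nth _ 0%N) => [|i]; rewrite !size_map ?size_rev !size_iota // => lin.
rewrite !(nth_map 0%N) ?size_rev ?size_iota // nth_rev ?size_iota // !nth_iota //; lia.
Qed.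

Lemma hsizesE : [seq hlen i | i <- iota 0 n] = hsizes U.
Proof.
rewrite /hsizes size_U /hlen.
apply: (@eq_from_nth _ 0%N) => [|i]; rewrite !size_map ?size_rev !size_iota // => lin.
rewrite !(nth_map 0%N) ?size_rev ?size_iota // nth_rev ?size_iota // !nth_iota //; lia.
Qed.

Lemma bulk_weight_eq0 x (N S W E : bool) :
  ((~~ N + S + W + ~~ E != 2)%N || (N + ~~ S + ~~ W + E != 2)%N) ->
  bulk_weight q x N S W E = 0.
Proof. by case: N; case: S; case: W; case: E. Qed.

Definition two_in_two_out (o : orientation n) :=
  [forall w : grid n, is_bulk n w.1 w.2 ==>
    (bulk_indeg o w.1 w.2 == 2) && (bulk_outdeg o w.1 w.2 == 2)].

Lemma config_weight_eq0 o : ~~ two_in_two_out o -> config_weight q p u v o = 0.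
Proof.
case/forallPn=> -[i j]; rewrite negb_imply /= => /andP[].
case/andP=> /andP[i1 iN] /andP[ij jn] ice.
rewrite /config_weight (big_cat_nat (n := i)) //=; last lia.
rewrite [X in _ * X * _ * _]big_ltn ?ltnS //.
rewrite [X in _ * (X * _)](big_cat_nat (n := j)) //=; last lia.
rewrite [X in _ * (_ * X * _)]big_ltn //.
rewrite bulk_weight_eq0; last by move: ice; rewrite negb_and.
by rewrite !(mul0r, mulr0).
Qed.

Section Encoding.
Variables (T H : seq (seq bool)).
Hypothesis shT : shape T = shape (edge_rows n vlen n.+1).
Hypothesis shH : shape H = shape (edge_rows n hlen n).

Definition encode : orientation n :=
  ([set e in mask (flatten T) (flatten (edge_rows n vlen n.+1))],
   [set e in mask (flatten H) (flatten (edge_rows n hlen n))]).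

Lemma points_up_encode i c : (i < n.+1)%N -> (c < vlen i)%N ->
  points_up encode i.+1 (i.+1 + c) = nth false (nth [::] T i) c.
Proof.
move=> iN cl; rewrite /points_up inE mem_mask_edge_rows //; exact: vlen_leq.
Qed.

Lemma points_right_encode i c : (i < n)%N -> (c < hlen i)%N ->
  points_right encode i.+1 (i.+1 + c) = nth false (nth [::] H i) c.
Proof.
move=> iN cl; rewrite /points_right inE mem_mask_edge_rows //; exact: hlen_leq.
Qed.

Lemma size_nth_T i : (i < n.+1)%N -> size (nth [::] T i) = vlen i.
Proof.
move=> iN; rewrite -nth_shape shT shape_edge_rows (nth_map 0%N) ?size_iota //.
by rewrite nth_iota.
Qed.

Lemma top_encode : [forall j : 'I_(2 * n).+2, is_vedge n 1 j ==> points_up encode 1 j]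
  = (nth [::] T 0 == nseq (2 * n).+1 true).
Proof.
have sT0 : size (nth [::] T 0) = (2 * n).+1 by rewrite size_nth_T // /vlen subn0.
apply/forallP/eqP => [up | T0 j].
  apply: (@eq_from_nth _ false); rewrite sT0 ?size_nseq // => c cn.
  have cj : (c.+1 < (2 * n).+2)%N by [].
  have := up (Ordinal cj); rewrite nth_nseq cn /= -(add1n c) points_up_encode //.
    by move/implyP; apply; rewrite /is_vedge /is_vertex; lia.
  by rewrite /vlen subn0.
apply/implyP => vj; have j1 : (0 < j)%N by move: vj; rewrite /is_vedge /is_vertex; lia.
have jn := ltn_ord j.
have -> : nat_of_ord j = (1 + j.-1)%N by lia.
rewrite points_up_encode // ?T0 ?nth_nseq /vlen ?subn0; last by lia.
by case: ltnP => //; lia.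
Qed.

Lemma bottom_encode : bottom_up encode = (nth [::] T n == [:: true]).
Proof.
rewrite /bottom_up -[X in points_up _ _ X]addn0 points_up_encode //.
have := size_nth_T (ltnSn n); rewrite /vlen subnn.
by case: (nth [::] T n) => [|[] [|? ?]].
Qed.

Lemma config_weight_encode : config_weight q p u v encode =
  \prod_(i < size U) full_row q p (nth v U i) (mirror_row v (drop i.+1 U))
     (nth [::] T i) (nth [::] H i) (nth [::] T i.+1).
Proof.
rewrite /config_weight -!big_split /= big_add1 /= big_mkord size_U.
apply: eq_bigr => -[i iN] _ /=; rewrite /full_row !spectralE /=.
have sm : size (mirror_row v (drop i.+1 U)) = (2 * (n - i.+1)).+1.
  by rewrite size_mirror_row size_drop size_U.
rewrite sm [in LHS](mulrC (\prod_(_ <= j < _) _)); congr (_ * _ * _).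
- rewrite -{2 4}[i.+1]addn0 points_up_encode ?points_right_encode // /hlen; lia.
- rewrite -{1}[i.+2]add0n big_addn.
  have -> : (2 * n + 2 - i.+1 - i.+2 = (2 * (n - i.+1)).+1)%N by lia.
  rewrite big_mkord; apply: eq_bigr => -[c cn] _ /=.
  rewrite spectralE nth_mirror_row size_drop size_U ?nth_drop //.
  (* The rows of vertical edges start on the diagonal, one column later for each row down: at the
     bulk vertex in column i + 2 + c the edge above has index c + 1 and the edge below has index
     c. *)
  have cE : (c + i.+2 = i.+1 + c.+1)%N by lia.
  have cE2 : (c + i.+2 = i.+2 + c)%N by lia.
  have cE3 : ((c + i.+2).-1 = i.+1 + c)%N by lia.
  congr (bulk_weight _ (_ * nth _ _ _) _ _ _ _).
  + lia.
  + by rewrite cE points_up_encode // /vlen; lia.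
  + by rewrite cE2 points_up_encode // /vlen; lia.
  + by rewrite cE3 points_right_encode // /hlen; lia.
  + by rewrite cE points_right_encode // /hlen; lia.
congr (right_weight _ _ _ _ (~~ _)).
- have -> : (2 * n + 2 - i.+1 = i.+1 + (2 * (n - i.+1)).+2)%N by lia.
  by rewrite points_up_encode // /vlen; lia.
have -> : (2 * n + 1 - i.+1 = i.+1 + (2 * (n - i.+1)).+1)%N by lia.
by rewrite points_right_encode // /hlen; lia.
Qed.

End Encoding.

(** An orientation is a pair of edge sets, hence a pair of bit sequences cut into rows; the
    conditions on top and bottom edges become Boolean factors. *)
Lemma Zup_QASTE : Zup_QAST q p u v = Zup q p v U.
Proof.
pose VE := flatten (edge_rows n vlen n.+1); pose HE := flatten (edge_rows n hlen n).
pose top (o : orientation n) :=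
  [forall j : 'I_(2 * n).+2, is_vedge n 1 j ==> points_up o 1 j].
pose F (o : orientation n) := if top o && bottom_up o then config_weight q p u v o else 0.
have VEE : [set e : grid n | is_vedge n e.1 e.2] = [set e in VE].
  by apply/setP => e; rewrite !inE is_vedgeE.
have HEE : [set e : grid n | is_hedge n e.1 e.2] = [set e in HE].
  by apply/setP => e; rewrite !inE is_hedgeE.
transitivity (\sum_(o : orientation n |
    (o.1 \subset [set e in VE]) && (o.2 \subset [set e in HE])) F o).
  rewrite /Zup_QAST big_mkcond [RHS]big_mkcond; apply: eq_bigr => o _.
  rewrite /is_config /is_orientation VEE HEE -/(two_in_two_out o) -/(top o) /F.
  case: ((o.1 \subset _) && (o.2 \subset _)) => //=.
  have [ice | /config_weight_eq0 ->] := boolP (two_in_two_out o).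
    by [].
  by rewrite /= if_same.
transitivity (\sum_(V : {set grid n} | V \subset [set e in VE])
    \sum_(H : {set grid n} | H \subset [set e in HE]) F (V, H)).
  by rewrite pair_big; apply: eq_big => [[] | []].
rewrite sum_subset_bits; last by apply: uniq_edge_rows => //; exact: vlen_leq.
under eq_sum_bits => s _ do
  (rewrite sum_subset_bits; last by apply: uniq_edge_rows => //; exact: hlen_leq).
rewrite !size_flatten sum_bits_rows.
under eq_sum_rows => T _ do rewrite sum_bits_rows.
have shV : shape (edge_rows n vlen n.+1) = (2 * n).+1 :: vsizes U.
  by rewrite shape_edge_rows vsizesE.
have shH : shape (edge_rows n hlen n) = hsizes U by rewrite shape_edge_rows hsizesE.
rewrite shV shH.
transitivity (sum_rows ((2 * n).+1 :: vsizes U) (fun T => sum_rows (hsizes U) (fun H =>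
   (nth [::] T 0 == nseq (2 * n).+1 true)%:R * full_weight q p v U T H))).
  apply: eq_sum_rows => T shT; apply: eq_sum_rows => H shH'.
  rewrite -shV in shT; rewrite -shH in shH'.
  rewrite -[(_, _)]/(encode T H) /F /top top_encode // bottom_encode //.
  rewrite config_weight_encode //.
  rewrite /full_weight size_U; case: (_ == nseq _ _); case: (_ == [:: true]);
  by rewrite /= ?mulr1 ?mul1r ?mulr0 ?mul0r.
rewrite sum_rows_cons (sum_bits_single (s0 := nseq (2 * n).+1 true)) ?size_nseq //.
  rewrite /Zup size_U Zrec_full ?size_nseq ?size_U //.
  apply: eq_sum_rows => T _; apply: eq_sum_rows => H _.
  by rewrite eqxx mul1r.
move=> s _ ns; transitivity (sum_rows (vsizes U) (fun=> 0 * (0 : K))).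
  apply: eq_sum_rows => T _ /=.
  by rewrite (sum_rowsZ _ (s == _)%:R) (negPf ns) !mul0r.
by rewrite sum_rowsZ mul0r.
Qed.

End FrozenPartitionFunction.

(** * Indeterminates *)

Section RootConstant.
Variable R : realType.

Lemma expiD (a b : R) : expi (a + b) = expi a * expi b.
Proof. by rewrite /expi cosD sinD; apply/eqP; rewrite eq_complex /= eqxx addrC eqxx. Qed.

Lemma expiMn (a : R) m : expi (a *+ m) = expi a ^+ m.
Proof.
elim: m => [|m IH]; last by rewrite mulrS expiD IH exprS.
by rewrite mulr0n expr0 /expi cos0 sin0.
Qed.

(** c ^ 6 + 1 = (c ^ 2 + 1) (c ^ 4 - c ^ 2 + 1) vanishes, and c ^ 2 is not -1 because its imaginary
    part sin (pi / 3) is positive. *)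
Lemma expi_pi6 : let c := expi (pi / 6%:R : R) in c ^+ 4 = c ^+ 2 - 1.
Proof.
move=> c; have c6 : c ^+ 6 + 1 = 0.
  rewrite -expiMn -(mulr_natr (pi / 6%:R)) divfK ?pnatr_eq0 // /expi cospi sinpi.
  by apply/eqP; rewrite eq_complex /= addNr addr0 !eqxx.
have c2 : c ^+ 2 + 1 != 0.
  rewrite -expiMn eq_complex /= negb_and addr0; apply/orP; right.
  apply: lt0r_neq0; apply: sin_gt0_pi; have := pi_gt0 R => pi0.
  rewrite -(mulr_natr (pi / 6%:R)); apply/andP; split.
    by rewrite !mulr_gt0 ?invr_gt0.
  by rewrite -mulrA gtr_pMr // mulrC ltr_pdivrMr ?ltr0n // mul1r ltr_nat.
apply/eqP; rewrite -subr_eq0; apply/eqP; apply: (mulfI c2); rewrite mulr0 -c6; ring.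
Qed.

End RootConstant.

Section Indeterminates.
Variables (R : realType) (n : nat).

Local Notation A := {mpoly R[i][n.+1]}.
Local Notation K := (ratfun R n).

(** A common index for p (at [ord0]) and the u_i (at the lifted indices), so that general position
    is proved for all of them at once. *)
Definition indet (k : 'I_n.+1) : K := FracField.tofrac ('X_k : A).

Lemma natr_ratfun_neq0 m : (m.+1%:R : K) != 0.
Proof.
rewrite -(rmorph_nat (@FracField.tofrac A)) tofrac_eq0 -mpolyC_nat mpolyC_eq0.
by rewrite pnatr_eq0.
Qed.

Lemma meval_indet (k : 'I_n.+1) (x : 'I_n.+1 -> R[i]) m :
  (('X_k : A) ^+ m).@[x] = x k ^+ m.
Proof. by rewrite rmorphXn /= mevalXU. Qed.

Lemma indet_expn_neq (k : 'I_n.+1) (l : 'I_n.+1) m : k != l -> (0 < m)%N ->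
  indet k ^+ m != indet l ^+ m.
Proof.
move=> kl m0; rewrite /indet -!rmorphXn /= tofrac_eq.
apply/eqP => /(congr1 (meval (fun j => (j == k)%:R : R[i]))).
rewrite !meval_indet eqxx eq_sym (negPf kl) expr1n expr0n gtn_eqF //=.
by move/eqP; rewrite oner_eq0.
Qed.

Lemma indet_expn_mul_neq1 k l m : (0 < m)%N -> indet k ^+ m * indet l ^+ m != 1.
Proof.
move=> m0; rewrite /indet -!rmorphXn -rmorphM -(rmorph1 (@FracField.tofrac A)) tofrac_eq.
apply/eqP => /(congr1 (meval (fun _ => 0 : R[i]))).
rewrite mevalM !meval_indet meval1 expr0n gtn_eqF //= mul0r.
by move/esym/eqP; rewrite oner_eq0.
Qed.

Lemma indet_neq0 k : indet k != 0.
Proof.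
rewrite tofrac_eq0; apply/eqP => /(congr1 (meval (fun _ => 1 : R[i]))).
by rewrite -[X in X.@[_]]expr1 meval_indet rmorph0 expr1 => /eqP; rewrite oner_eq0.
Qed.

Lemma generic_indet (ks : seq 'I_n.+1) : uniq ks -> generic [seq indet k | k <- ks].
Proof.
apply: generic_map => [k | k l | k l kl]; first exact: indet_neq0.
  exact: indet_expn_mul_neq1.
exact: indet_expn_neq.
Qed.

End Indeterminates.

Lemma Zup_QAST_formula (K : fieldType) (q p : K) n (u : 'I_n -> K) :
  q ^+ 4 = q ^+ 2 - 1 -> (2%:R : K) != 0 -> (3%:R : K) != 0 ->
  generic (p :: [seq u i | i <- enum 'I_n]) ->
  Zup_QAST q p u p =
    3%:R ^- 'C(n.+1, 2)
    * (\prod_(i < n) (p ^+ 2 * u i ^+ 2 + 1 + p ^- 2 * u i ^- 2))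
    * schur (double_staircase n) (squares_inv u).
Proof.
move=> q4 two three gU; have [p0 _ _ _] := generic_cons gU.
rewrite Zup_QASTE Zup_formula // /product_formula size_map size_enum_ord.
congr (_ * _ * _); first by rewrite big_map big_enum.
rewrite /staircase_schur /alternant /vdm /det_fun /schur.
have E (k : 'I_(2 * n)) : squares_inv u k =
    (with_inverses [seq w ^+ 2 | w <- [seq u i | i <- enum 'I_n]])`_k.
  by rewrite /squares_inv /with_inverses -!map_comp.
congr (\det _ / _); first by apply/matrixP => i j; rewrite !mxE E.
by apply: eq_bigr => i _; apply: eq_bigr => j _; rewrite !E.
Qed.

Theorem theorem6p3 (R : realType) (n : nat) (n_gt0 : (0 < n)%N) :
  let q := const_q R n in
  let p := indet_p R n in
  let u := @indet_u R n in
  Zup_QAST q p u p =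
    3%:R ^- 'C(n.+1, 2)
    * (\prod_(i < n) (p ^+ 2 * u i ^+ 2 + 1 + p ^- 2 * u i ^- 2))
    * schur (double_staircase n) (squares_inv u).
Proof.
move=> q p u; apply: Zup_QAST_formula.
- by rewrite /q /const_q -!rmorphXn /= expi_pi6 !rmorphB /= !rmorph1.
- exact: natr_ratfun_neq0.
- exact: natr_ratfun_neq0.
have -> : p :: [seq u i | i <- enum 'I_n] =
    [seq indet R k | k <- ord0 :: [seq lift ord0 i | i <- enum 'I_n]].
  by rewrite /= -map_comp.
apply: generic_indet; rewrite /= map_inj_uniq ?enum_uniq ?andbT; last exact: lift_inj.
by apply/mapP => -[k _ /eqP]; rewrite (negPf (neq_lift _ _)).
Qed.
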